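(* The sectional curvature of the Bures-Wasserstein metric on $\mathrm{SPD}(n)$ is non-negative. More precisely, for all $\Sigma=PDP^\top\in\mathrm{SPD}(n)$, with $P\in\mathrm{O}(n)$ and $D=\mathrm{Diag}(d_1,\dots,d_n)$, and all $X,Y\in T_\Sigma\mathrm{SPD}(n)=\mathrm{Sym}(n)$, $$R_\Sigma(X,Y,X,Y)=\frac32\sum_{i,j}\frac{d_id_j}{d_i+d_j}\Big(\big[{X^0}',{Y^0}'\big]_{ij}\Big)^2,$$ where ${X^0}',{Y^0}'\in\mathrm{Sym}(n)$ are defined by $P^\top XP=D{X^0}'+{X^0}'D$ and $P^\top YP=D{Y^0}'+{Y^0}'D$, and $[V,W]=VW-WV$ is the matrix Lie bracket.
   Context: $\mathrm{SPD}(n)$ is the manifold of real symmetric positive definite $n\times n$ matrices, an open subset of the space $\mathrm{Sym}(n)$ of symmetric matrices; tangent spaces are identified with $\mathrm{Sym}(n)$. The Bures-Wasserstein metric is $g_\Sigma(X,X)=\frac12\sum_{i,j}\frac{1}{d_i+d_j}X_{ij}'^2$ where $\Sigma=PDP^\top$ with $P\in\mathrm{O}(n)$, $D=\mathrm{Diag}(d_1,\dots,d_n)$ and $X'=P^\top XP$. The convention for the curvature is that the sectional curvature is $\kappa(X,Y)=\frac{R(X,Y,X,Y)}{\|X\|^2\|Y\|^2-\langle X,Y\rangle^2}$, i.e. $R(X,Y,X,Y)=g(R(X,Y)Y,X)$ with $R(X,Y)Z=\nabla_X\nabla_YZ-\nabla_Y\nabla_XZ-\nabla_{[X,Y]}Z$.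 *)

(* Defs.v *)
From HB Require Import structures.
From mathcomp Require Import all_boot all_order all_algebra.
From mathcomp Require Import all_classical all_reals all_analysis.

Set Implicit Arguments.
Unset Strict Implicit.
Unset Printing Implicit Defensive.

Import Order.TTheory GRing.Theory Num.Theory.
Import numFieldNormedType.Exports.

Local Open Scope classical_set_scope.
Local Open Scope ring_scope.

Section SPDManifold.
Variables (R : realType) (n : nat).
Local Notation M := 'M[R]_n.

Definition Sym : set M := [set A | A^T = A].

Definition SPD : set M :=
  [set A | A^T = A /\
    forall u : 'rV[R]_n, u != 0 -> 0 < (u *m A *m u^T) ord0 ord0].

Definition orthogonal_mx (P : M) : Prop := P^T *m P = 1%:M.

Definition eigendecomposition (S P : M) (d : 'rV[R]_n) : Prop :=
  orthogonal_mx P /\ S = P *m diag_mx d *m P^T.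

Definition mxbracket (V W : M) : M := V *m W - W *m V.

(* Functions and vector fields on SPD(n) are represented by total functions on
   the space of all square matrices, of which only the values on SPD(n) matter.
   As SPD(n) is open in Sym(n), the derivatives below, which are taken at
   points of SPD(n) in symmetric directions, depend on these values only. *)

(* C^k on SPD(n): all iterated derivatives up to order k along constant
   symmetric directions exist and are continuous on SPD(n). *)
Fixpoint Ck (k : nat) (V : normedModType R) (f : M -> V) : Prop :=
  {within SPD, continuous f} /\
  (if k is k'.+1 then
     forall v : M, Sym v ->
       (forall x, SPD x -> derivable f x v) /\ Ck k' ('D_v f)
   else True).

Definition smooth (V : normedModType R) (f : M -> V) : Prop :=
  forall k, Ck k f.

Definition vector_field (X : M -> M) : Prop :=
  smooth X /\ (forall x, SPD x -> Sym (X x)).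

(* The derivative of f along the vector field X. *)
Definition dir_derive (V : normedModType R) (X : M -> M) (f : M -> V) : M -> V :=
  fun x => 'D_(X x) f x.

Definition lie_bracket (X Y : M -> M) : M -> M :=
  fun x => dir_derive X Y x - dir_derive Y X x.

Record levi_civita (g : M -> M -> M -> R) (nabla : (M -> M) -> (M -> M) -> M -> M)
    : Prop := LeviCivita {
  lc_vector_field : forall X Y, vector_field X -> vector_field Y ->
    vector_field (nabla X Y) ;
  lc_addl : forall X X' Y,
    vector_field X -> vector_field X' -> vector_field Y ->
    forall x, SPD x ->
      nabla (fun y => X y + X' y) Y x = nabla X Y x + nabla X' Y x ;
  lc_scalel : forall (f : M -> R^o) X Y,
    smooth f -> vector_field X -> vector_field Y ->
    forall x, SPD x -> nabla (fun y => f y *: X y) Y x = f x *: nabla X Y x ;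
  lc_addr : forall X Y Y',
    vector_field X -> vector_field Y -> vector_field Y' ->
    forall x, SPD x ->
      nabla X (fun y => Y y + Y' y) x = nabla X Y x + nabla X Y' x ;
  lc_leibniz : forall (f : M -> R^o) X Y,
    smooth f -> vector_field X -> vector_field Y ->
    forall x, SPD x ->
      nabla X (fun y => f y *: Y y) x =
      dir_derive X f x *: Y x + f x *: nabla X Y x ;
  lc_torsion_free : forall X Y, vector_field X -> vector_field Y ->
    forall x, SPD x -> nabla X Y x - nabla Y X x = lie_bracket X Y x ;
  lc_metric : forall X Y Z,
    vector_field X -> vector_field Y -> vector_field Z ->
    forall x, SPD x ->
      dir_derive X (fun y => g y (Y y) (Z y) : R^o) x =
      g x (nabla X Y x) (Z x) + g x (Y x) (nabla X Z x)
}.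

Definition curvature (nabla : (M -> M) -> (M -> M) -> M -> M)
    (X Y Z : M -> M) : M -> M :=
  fun x => nabla X (nabla Y Z) x - nabla Y (nabla X Z) x
           - nabla (lie_bracket X Y) Z x.

(* Sign convention: R(X, Y, Z, W) = g(R(X, Y) W, Z), so that R(X, Y, X, Y) is
   the numerator of the sectional curvature. *)
Definition riemann (g : M -> M -> M -> R) (nabla : (M -> M) -> (M -> M) -> M -> M)
    (X Y Z W : M -> M) (x : M) : R :=
  g x (curvature nabla X Y W x) (Z x).

Definition sectional_curvature (g : M -> M -> M -> R)
    (nabla : (M -> M) -> (M -> M) -> M -> M) (X Y : M -> M) (x : M) : R :=
  riemann g nabla X Y X Y x /
  (g x (X x) (X x) * g x (Y x) (Y x) - g x (X x) (Y x) ^+ 2).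

(* The polarization of the quadratic form
   (1/2) sum_ij X'_ij ^ 2 / (d_i + d_j), where X' = P^T X P, read in some
   eigendecomposition S = P diag(d) P^T; the value does not depend on the
   choice of the decomposition. *)
Definition bures_wasserstein (S X Y : M) : R :=
  let Pd := get [set Pd : M * 'rV[R]_n | eigendecomposition S Pd.1 Pd.2] in
  let P := Pd.1 in
  let d := Pd.2 in
  let X' := P^T *m X *m P in
  let Y' := P^T *m Y *m P in
  2^-1 * \sum_(i < n) \sum_(j < n)
    (d ord0 i + d ord0 j)^-1 * (X' i j * Y' i j).

End SPDManifold.

(* Main.v *)
(* Write X0 for the solution of S X0 + X0 S = X, so that g_S(X,Y) = tr(X0 Y) / 2.
   Differentiating this equation along a line gives the derivative of g, and
   Koszul's formula then yields
     nabla_X Y = D_X Y - (X0 S Y0 + Y0 S X0).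
   As the second derivatives commute, inserting this in the definition of the
   curvature leaves an algebraic expression in S, X0 and Y0: with
   C = [X0, Y0] and K the solution of S K + K S = [S, C],
     R(X,Y)Y = 3/2 (K S Y0 + Y0 S K + C S Y0 - Y0 S C),
     R(X,Y,X,Y) = - 3/4 (tr(K S K) + tr(C S C)).
   In an eigenbasis of S one has K_ij = (d_i - d_j) / (d_i + d_j) C_ij, and
   symmetrizing in i and j gives the formula. *)

Require Import Defs.
From HB Require Import structures.
From mathcomp Require Import all_boot all_order all_algebra.
From mathcomp Require Import all_classical all_reals all_analysis.
From mathcomp Require Import ring lra.

Set Implicit Arguments.
Unset Strict Implicit.
Unset Printing Implicit Defensive.

Import Order.TTheory GRing.Theory Num.Theory.
Import numFieldNormedType.Exports.

Local Open Scope classical_set_scope.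
Local Open Scope ring_scope.

(** * The spectral theorem *)

Section SpectralTheorem.
Variables (R : realType) (n : nat).
Local Notation M := 'M[R]_n.

(** The metric is read in an eigenbasis picked by [get], so nothing can be said about it before the
    spectral theorem is available; the trace formula tr(X0 Y) / 2 then forgets the choice.
    Smoothness here means only that iterated derivatives along constant symmetric directions exist
    and are continuous. Hence linearity of ['D_v Z] in [v], a chain rule and the commutation of
    second derivatives all have to be earned. Commutation comes from comparing second differences.
    Linearity is drawn from the connection itself: torsion-freeness writes ['D_v Z] through [nabla],
    which is linear over constants in both slots. Expanding a field in constant symmetric directions
    then makes it possible to differentiate ['D_(Y y) Z y], the term of [nabla Y Z] whose direction
    moves with the point. Likewise, the smoothness of Lie brackets is inherited from the closure of
    vector fields under [nabla] instead of being computed. *)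

Fact entryD (m p : nat) (A B : 'M[R]_(m, p)) i j : (A + B) i j = A i j + B i j.
Proof. by rewrite mxE. Qed.

Fact entryN (m p : nat) (A : 'M[R]_(m, p)) i j : (- A) i j = - A i j.
Proof. by rewrite mxE. Qed.

Fact entryZ (m p : nat) (a : R) (A : 'M[R]_(m, p)) i j : (a *: A) i j = a * A i j.
Proof. by rewrite mxE. Qed.

Fact trmxD (m p : nat) (A B : 'M[R]_(m, p)) : (A + B)^T = A^T + B^T.
Proof. exact: raddfD. Qed.

Fact trmxN (m p : nat) (A : 'M[R]_(m, p)) : (- A)^T = - A^T.
Proof. exact: raddfN. Qed.

Fact mxtraceN (m : nat) (A : 'M[R]_m) : \tr (- A) = - \tr A.
Proof. exact: raddfN. Qed.

Lemma orthogonal_mxV (P : M) : orthogonal_mx P -> P *m P^T = 1%:M.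
Proof. exact: mulmx1C. Qed.

Lemma continuous_mulmx_entry (T : topologicalType) (m p q : nat)
    (A : T -> 'M[R]_(m, p)) (B : T -> 'M[R]_(p, q)) :
  (forall i j, continuous (fun w => A w i j)) ->
  (forall i j, continuous (fun w => B w i j)) ->
  forall i j, continuous (fun w => (A w *m B w) i j).
Proof.
move=> cA cB i j.
rewrite (_ : (fun w => _) = fun w => \sum_k A w i k * B w k j); last first.
  by apply/funext => v; rewrite mxE.
apply: continuous_big => [|k _ w]; first exact: add_continuous.
by apply: cvgM; [exact: cA|exact: cB].
Qed.

Lemma continuous_vec_mx_entry i j :
  continuous (fun w : 'rV[R]_(n * n) => (vec_mx w : M) i j).
Proof.
rewrite (_ : (fun w => _) = fun w : 'rV[R]_(n * n) => w ord0 (mxvec_index i j)).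
  exact: coord_continuous.
by apply/funext => v; rewrite mxE.
Qed.

Lemma continuous_tr_vec_mx_entry i j :
  continuous (fun w : 'rV[R]_(n * n) => (vec_mx w : M)^T i j).
Proof.
rewrite (_ : (fun w => _) = fun w : 'rV[R]_(n * n) => (vec_mx w : M) j i).
  exact: continuous_vec_mx_entry.
by apply/funext => v; rewrite mxE.
Qed.

(** Bounded because the rows of an orthogonal matrix are unit vectors, closed because it is cut out
    by the entries of P^T P = 1. Matrices are flattened to row vectors, the form in which the
    extreme value theorem is applied. *)
Lemma compact_orthogonal :
  compact [set w : 'rV[R]_(n * n) | orthogonal_mx (vec_mx w : M)].
Proof.
apply: bounded_closed_compact.
  exists 1; split => // c c1 w /= /orthogonal_mxV Pw.
  apply: le_trans (ltW c1); rewrite [leLHS]/Num.Def.normr/= mx_normrE.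
  apply/bigmax_leP; split => // -[a b] _ /=; rewrite (ord1 a) {a}.
  case/mxvec_indexP: b => i j.
  have := congr1 (fun X : M => X i i) Pw; rewrite !mxE eqxx => Pii.
  rewrite -(ler_pXn2r (n := 2)) ?nnegrE// expr1n real_normK ?num_real//.
  rewrite -[leRHS]Pii (bigD1 j)//= [vec_mx w i j]mxE mxE mxE -expr2 lerDl.
  by apply: sumr_ge0 => k _; rewrite !mxE -expr2 sqr_ge0.
rewrite (_ : [set w | _] = \bigcap_(ij in [set: 'I_n * 'I_n])
    ((fun w : 'rV[R]_(n * n) => ((vec_mx w : M)^T *m vec_mx w) ij.1 ij.2)
      @^-1` [set (1%:M : M) ij.1 ij.2])); last first.
  apply/seteqP; split => w /=; first by move=> Pw [i j] _ /=; rewrite Pw.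
  by move=> Pw; apply/matrixP => i j; exact: (Pw (i, j)).
apply: closed_bigI => -[i j] _ /=; apply: preimage_closed.
  move=> w _; apply: continuous_mulmx_entry => k l.
    exact: continuous_tr_vec_mx_entry.
  exact: continuous_vec_mx_entry.
exact: closed_eq.
Qed.

(** The two terms linear in [c] have the same trace because a 1x1 matrix equals its transpose, and
    the quadratic term factors because [w *m A *m w^T] is a scalar. This compares the objective of
    the maximization at P and at PQ. *)
Lemma mxtrace_conj_reflection (A N : M) (w : 'rV[R]_n) (c : R) :
  A^T = A -> N^T = N ->
  let Q := 1%:M - c *: (w^T *m w) in
  \tr (N *m (Q *m A *m Q)) = \tr (N *m A)
    - c * ((w *m A *m N *m w^T) ord0 ord0) *+ 2
    + c ^+ 2 * ((w *m A *m w^T) ord0 ord0 * (w *m N *m w^T) ord0 ord0).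
Proof.
move=> sA sN Q; set a := (w *m A *m w^T) ord0 ord0.
have wAw : w *m A *m w^T = a%:M by rewrite [LHS]mx11_scalar.
have -> : Q *m A *m Q = A - c *: (w^T *m (w *m A)) - c *: (A *m w^T *m w)
    + (c ^+ 2 * a) *: (w^T *m w).
  rewrite /Q !(mulmxBl, mulmxBr, mul1mx, mulmx1, =^~ scalemxAl, =^~ scalemxAr).
  rewrite !mulmxA.
  have -> : w^T *m w *m A *m w^T *m w = a *: (w^T *m w).
    by rewrite -!mulmxA [w *m (A *m _)]mulmxA [w *m _ *m _]mulmxA wAw
      mul_scalar_mx -scalemxAr.
  by apply/matrixP => i j; rewrite !(entryD, entryN, entryZ); ring.
rewrite mulmxDr !mulmxBr -!scalemxAr !(mxtraceD, mxtraceN, mxtraceZ).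
have trw (B : 'cV[R]_n) : \tr (B *m w) = (w *m B) ord0 ord0.
  by rewrite mxtrace_mulC trace_mx11.
rewrite !mulmxA [\tr (N *m w^T *m w *m A)]mxtrace_mulC mulmxA.
rewrite [A *m (N *m _)]mulmxA !trw !mulmxA.
have -> : (w *m N *m A *m w^T) ord0 ord0 = (w *m A *m N *m w^T) ord0 ord0.
  rewrite -[LHS]trace_mx11 -mxtrace_tr !trmx_mul trmxK sA sN trace_mx11.
  by rewrite !mulmxA.
rewrite -/a; ring.
Qed.

Lemma sqnorm_gt0 (w : 'rV[R]_n) : w != 0 -> 0 < (w *m w^T) ord0 ord0.
Proof.
move=> w0; rewrite mxE lt_neqAle; apply/andP; split; last first.
  by apply: sumr_ge0 => k _; rewrite mxE -expr2 sqr_ge0.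
apply: contra w0; rewrite eq_sym psumr_eq0 => [/allP w0|k _]; last first.
  by rewrite mxE -expr2 sqr_ge0.
apply/eqP/rowP => k; have := w0 k (mem_index_enum _).
by rewrite /= !mxE mulf_eq0 orbb => /eqP.
Qed.

(** With q = |w|^2, orthogonality asks for c^2 q = 2c, whose nonzero root is 2/q. *)
Lemma orthogonal_reflection (w : 'rV[R]_n) : w != 0 ->
  orthogonal_mx (1%:M - (2 / (w *m w^T) ord0 ord0) *: (w^T *m w)).
Proof.
move=> /sqnorm_gt0; set q := (w *m w^T) ord0 ord0 => q0.
have wq : w *m w^T = q%:M by rewrite [LHS]mx11_scalar.
rewrite /orthogonal_mx; set c := 2 / q.
have -> : (1%:M - c *: (w^T *m w))^T = 1%:M - c *: (w^T *m w).
  by rewrite linearB linearZ /= trmx1 trmx_mul trmxK.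
rewrite !(mulmxBl, mulmxBr, mul1mx, mulmx1, =^~ scalemxAl, =^~ scalemxAr).
rewrite -mulmxA [w *m (_ *m _)]mulmxA wq mul_scalar_mx -scalemxAr.
apply/matrixP => i j; rewrite !(entryD, entryN, entryZ) /c.
by field; rewrite gt_eqF.
Qed.

(** Testing the hypothesis on e_i + t e_j gives t mu (1 - t^2) <= t^2 k with mu = A_ij (p_i - p_j).
    For small t of the sign of mu the linear term dominates, so mu = 0. *)
Lemma offdiag_eq0 (A : M) (p : 'rV[R]_n) : A^T = A ->
  (forall w : 'rV[R]_n,
    (w *m A *m w^T) ord0 ord0 * (w *m diag_mx p *m w^T) ord0 ord0 <=
    (w *m A *m diag_mx p *m w^T) ord0 ord0 * (w *m w^T) ord0 ord0) ->
  forall i j, p ord0 i != p ord0 j -> A i j = 0.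
Proof.
move=> sA Aopt i j pij; apply/eqP/negP => /negP mij.
have neq_ij : i != j by apply: contraNneq pij => ->.
set e := fun k : 'I_n => delta_mx ord0 k : 'rV[R]_n.
have eBe (B : M) k l : (e k *m B *m (e l)^T) ord0 ord0 = B k l.
  by rewrite trmx_delta -rowE -colE !mxE.
have ee k l : (e k *m (e l)^T) ord0 ord0 = (k == l)%:R.
  by rewrite -[e k]mulmx1 eBe mxE.
have Adp k l : (A *m diag_mx p) k l = A k l * p ord0 l.
  by rewrite mul_mx_diag mxE.
have Aji : A j i = A i j by rewrite -[in LHS]sA mxE.
set m := A i j in mij Aji; set a := A i i; set b := A j j.
set pi := p ord0 i in pij; set pj := p ord0 j in pij.
have ineq t : t * (m * (pi - pj)) * (1 - t ^+ 2) <= t ^+ 2 * ((pi - pj) * (a - b)).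
  have := Aopt (e i + t *: e j).
  rewrite -[_ *m A *m diag_mx p]mulmxA.
  rewrite linearD linearZ /= !(mulmxDl, mulmxDr, =^~ scalemxAl, =^~ scalemxAr).
  rewrite !(entryD, entryZ) !eBe !ee !Adp !mxE !eqxx (negbTE neq_ij).
  rewrite eq_sym (negbTE neq_ij) Aji -/m -/a -/b -/pi -/pj !mulr1n !mulr0n.
  move=> h; rewrite -subr_ge0; move: h; rewrite -subr_ge0.
  by congr (0 <= _); ring.
set mu := m * (pi - pj) in ineq.
have mu0 : 0 < mu ^+ 2 by rewrite exprn_even_gt0//= mulf_neq0// subr_eq0.
set k := (pi - pj) * (a - b) in ineq.
(* With t = mu / K the inequality reduces to K - mu^2 / K <= k, which fails since K >= 1 gives K -
   mu^2 / K >= 1 + |k|. *)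
set K := 1 + mu ^+ 2 + `|k|.
have K0 : 0 < K by rewrite /K; have := normr_ge0 k; lra.
have := ineq (mu / K).
rewrite (_ : _ * _ * _ = mu ^+ 2 / K ^+ 2 * (K - mu ^+ 2 / K)); last first.
  by field; rewrite gt_eqF.
rewrite (_ : (mu / K) ^+ 2 * k = mu ^+ 2 / K ^+ 2 * k); last first.
  by field; rewrite gt_eqF.
rewrite ler_pM2l => [h|]; last by rewrite divr_gt0// exprn_gt0.
have : mu ^+ 2 / K <= mu ^+ 2.
  rewrite ler_pdivrMr// ler_peMr ?(ltW mu0)//.
  by rewrite /K; have := normr_ge0 k; lra.
by have := ler_norm k; move: h; rewrite /K; lra.
Qed.

(* Maximize tr(N P^T S P) over the orthogonal group, with N diagonal with
   distinct entries. Varying P by reflections shows that P^T S P commutes with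
   N at a maximizer. *)
Lemma spectral_theorem (S : M) : S^T = S ->
  exists P : M, exists d : 'rV[R]_n, eigendecomposition S P d.
Proof.
move=> sS; set p : 'rV[R]_n := \row_i (i%:R).
pose f (w : 'rV[R]_(n * n)) :=
  \tr (diag_mx p *m ((vec_mx w)^T *m S *m vec_mx w)).
have cf : continuous f.
  apply: continuous_big => [|k _]; first exact: add_continuous.
  apply: continuous_mulmx_entry => [? ?|]; first exact: cst_continuous.
  apply: continuous_mulmx_entry => [|i j]; last exact: continuous_vec_mx_entry.
  apply: continuous_mulmx_entry => i j; last exact: cst_continuous.
  exact: continuous_tr_vec_mx_entry.
have [||w] := @EVT_max_rV _ _ f _ _ compact_orthogonal.
- by exists (mxvec 1%:M); rewrite /= /orthogonal_mx mxvecK trmx1 mul1mx.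
- exact: continuous_subspaceT.
rewrite inE /=; set P := vec_mx w => oP fmax.
set A := P^T *m S *m P.
have sA : A^T = A by rewrite /A !trmx_mul trmxK sS mulmxA.
have oP' := orthogonal_mxV oP.
have Aoff : forall i j, p ord0 i != p ord0 j -> A i j = 0.
  apply: offdiag_eq0 => // u; have [->|u0] := eqVneq u 0.
    by rewrite !mul0mx !mxE !mul0r.
  have q0 := sqnorm_gt0 u0; set q := (u *m u^T) ord0 ord0 in q0 *.
  set Q : M := 1%:M - (2 / q) *: (u^T *m u).
  have oQ : orthogonal_mx Q by exact: orthogonal_reflection.
  have := fmax (mxvec (P *m Q)); rewrite inE /= /orthogonal_mx mxvecK.
  rewrite trmx_mul mulmxA -[Q^T *m P^T *m P]mulmxA oP mulmx1 oQ => /(_ erefl).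
  rewrite /f mxvecK -/P trmx_mul.
  have -> : Q^T *m P^T *m S *m (P *m Q) = Q *m A *m Q.
    rewrite /A !mulmxA; congr (_ *m _ *m _ *m _ *m _).
    by rewrite /Q linearB linearZ /= trmx1 trmx_mul trmxK.
  rewrite -/A mxtrace_conj_reflection// ?tr_diag_mx//.
  set x := (u *m A *m _ *m _) _ _.
  set y := (u *m A *m _) _ _ * (u *m diag_mx p *m _) _ _; set T := \tr _.
  (* For c = 2/q one has 2c = c^2 q, so the change of the objective is c^2 (y - x q). Maximality
     makes it nonpositive, which is the inequality that [offdiag_eq0] requires. *)
  move=> h; have : (2 / q) ^+ 2 * (y - x * q) <= 0.
    rewrite (_ : _ * _ = - ((2 / q * x) *+ 2) + (2 / q) ^+ 2 * y).
      by rewrite -(lerD2l T) addr0 addrA.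
    by field; rewrite gt_eqF.
  by rewrite pmulr_rle0 ?subr_le0// exprn_gt0// divr_gt0.
exists P, (\row_i A i i); split => //=.
rewrite (_ : diag_mx _ = A).
  by rewrite /A !mulmxA oP' mul1mx -mulmxA oP' mulmx1.
apply/matrixP => i j; rewrite [LHS]mxE.
have [->|ij] := eqVneq i j; first by rewrite mulr1n mxE.
by rewrite mulr0n Aoff// !mxE eqr_nat.
Qed.

End SpectralTheorem.

(** * The Lyapunov equation and the metric *)

Section LyapunovOperator.
Variables (R : realType) (n : nat).
Local Notation M := 'M[R]_n.

Fact mul_diag_entry (d : 'rV[R]_n) (A : M) i j :
  (diag_mx d *m A) i j = d ord0 i * A i j.
Proof. by rewrite mul_diag_mx mxE. Qed.

Fact mul_mx_diag_entry (d : 'rV[R]_n) (A : M) i j :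
  (A *m diag_mx d) i j = A i j * d ord0 j.
Proof. by rewrite mul_mx_diag mxE. Qed.

Lemma SPD_sym (S : M) : SPD S -> S^T = S.
Proof. by case. Qed.

Lemma eigendecomposition_conj (S P : M) (d : 'rV[R]_n) :
  eigendecomposition S P d -> P^T *m S *m P = diag_mx d.
Proof.
by move=> [oP ->]; rewrite !mulmxA oP mul1mx -mulmxA oP mulmx1.
Qed.

Lemma SPD_eigenvalue_gt0 (S P : M) (d : 'rV[R]_n) :
  SPD S -> eigendecomposition S P d -> forall i, 0 < d ord0 i.
Proof.
move=> [_ Spos] SPd i; have [oP _] := SPd.
set e : 'rV[R]_n := delta_mx ord0 i.
have := Spos (e *m P^T).
have -> : e *m P^T *m S *m (e *m P^T)^T = e *m diag_mx d *m e^T.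
  by rewrite [(e *m _)^T]trmx_mul trmxK -(eigendecomposition_conj SPd) !mulmxA.
have -> : (e *m diag_mx d *m e^T) ord0 ord0 = d ord0 i.
  by rewrite /e trmx_delta -rowE -colE !mxE eqxx mulr1n.
apply.
apply/negP => /eqP/(congr1 (mulmxr P)) /=.
rewrite -mulmxA oP mulmx1 mul0mx => /rowP/(_ i)/eqP.
by rewrite !mxE !eqxx oner_eq0.
Qed.

Lemma qform_eigendecomposition (S P : M) (d : 'rV[R]_n) (u : 'rV[R]_n) :
  eigendecomposition S P d ->
  (u *m S *m u^T) ord0 ord0 = \sum_k d ord0 k * (u *m P) ord0 k ^+ 2.
Proof.
move=> [_ ->]; rewrite !mulmxA -[_ *m P^T *m u^T]mulmxA -trmx_mul mul_mx_diag.
by rewrite mxE; apply: eq_bigr => k _; rewrite !mxE; ring.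
Qed.

Lemma sqnorm_orthogonal (P : M) (u : 'rV[R]_n) : orthogonal_mx P ->
  (u *m u^T) ord0 ord0 = \sum_k (u *m P) ord0 k ^+ 2.
Proof.
move=> /orthogonal_mxV oP.
have -> : u *m u^T = u *m P *m (u *m P)^T.
  by rewrite trmx_mul mulmxA -[u *m P *m _]mulmxA oP mulmx1.
by rewrite mxE; apply: eq_bigr => k _; rewrite !mxE expr2.
Qed.

Lemma sqr_coord_le_sqnorm (u : 'rV[R]_n) k :
  u ord0 k ^+ 2 <= (u *m u^T) ord0 ord0.
Proof.
rewrite mxE (bigD1 k)//= mxE -expr2 lerDl.
by apply: sumr_ge0 => l _; rewrite mxE -expr2 sqr_ge0.
Qed.

(** Each product of two coordinates of [u] is at most |u|^2 in absolute value, so the sum of the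
    absolute values of the entries of [v] will do. *)
Lemma qform_le_sqnorm (v : M) : exists2 C : R, 0 <= C &
  forall u : 'rV[R]_n, `|(u *m v *m u^T) ord0 ord0| <= C * (u *m u^T) ord0 ord0.
Proof.
exists (\sum_k \sum_l `|v l k|) => [|u].
  by apply: sumr_ge0 => k _; apply: sumr_ge0.
rewrite mxE mulr_suml (le_trans (ler_norm_sum _ _ _))// ler_sum// => k _.
rewrite mxE mulr_suml mulr_suml (le_trans (ler_norm_sum _ _ _))// ler_sum// => l _.
rewrite mxE mulrAC normrM mulrC ler_wpM2l// ler_norml.
have := sqr_coord_le_sqnorm u k; have := sqr_coord_le_sqnorm u l.
have := sqr_ge0 (u ord0 k + u ord0 l); have := sqr_ge0 (u ord0 k - u ord0 l).
set a := u ord0 k; set b := u ord0 l; set q := (_ *m _) _ _.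
rewrite sqrrB sqrrD; move=> h1 h2 h3 h4; apply/andP; split; lra.
Qed.

Lemma SPD_coercive (S : M) : SPD S -> exists2 c : R, 0 < c &
  forall u : 'rV[R]_n, c * (u *m u^T) ord0 ord0 <= (u *m S *m u^T) ord0 ord0.
Proof.
move=> SS; have [P [d SPd]] := spectral_theorem (SPD_sym SS).
have d0 := SPD_eigenvalue_gt0 SS SPd.
(* [s] dominates every inverse eigenvalue, so its inverse lies below every eigenvalue; the summand 1
   keeps [s] positive when n = 0. *)
set s := 1 + \sum_i (d ord0 i)^-1.
have s0 : 0 < s by rewrite ltr_pwDl// sumr_ge0// => i _; rewrite invr_ge0 ltW.
exists s^-1 => [|u]; first by rewrite invr_gt0.
rewrite (sqnorm_orthogonal _ SPd.1) (qform_eigendecomposition _ SPd) mulr_sumr.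
apply: ler_sum => k _; apply: ler_wpM2r; first exact: sqr_ge0.
rewrite -[leRHS]invrK lef_pV2 ?posrE ?invr_gt0//.
rewrite /s (bigD1 k)//= addrCA lerDl addr_ge0// sumr_ge0// => i _.
by rewrite invr_ge0 ltW.
Qed.

(** Two directions are moved at once because the second differences of [derive_comm] need a whole
    parallelogram inside SPD. The radius makes the perturbation of the quadratic form smaller than
    the coercivity constant [c]. *)
Lemma SPD_open (x v w : M) : SPD x -> Sym v -> Sym w ->
  exists2 e : R, 0 < e &
    forall s t : R, `|s| <= e -> `|t| <= e -> SPD (s *: v + (t *: w + x)).
Proof.
move=> Sx sv sw; have [c c0 xc] := SPD_coercive Sx.
have [Cv Cv0 vC] := qform_le_sqnorm v; have [Cw Cw0 wC] := qform_le_sqnorm w.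
have C0 : 0 < 1 + Cv + Cw by lra.
exists (c / (2 * (1 + Cv + Cw))) => [|s t se te].
  by rewrite divr_gt0// mulr_gt0.
split=> [|u u0]; first by rewrite !linearD !linearZ /= sv sw SPD_sym.
rewrite !(mulmxDr, mulmxDl, =^~ scalemxAl, =^~ scalemxAr) !(entryD, entryZ).
move: (xc u) (vC u) (wC u) (sqnorm_gt0 u0).
set qv := (u *m v *m _) _ _; set qw := (u *m w *m _) _ _.
set qx := (u *m x *m _) _ _; set q := (_ *m _) _ _ => hx hv hw q0.
have bnd (r y C : R) : 0 <= C -> `|r| <= c / (2 * (1 + Cv + Cw)) ->
    `|y| <= C * q -> - (c / (2 * (1 + Cv + Cw)) * (C * q)) <= r * y.
  move=> CC hr hy; have : `|r * y| <= c / (2 * (1 + Cv + Cw)) * (C * q).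
    by rewrite normrM ler_pM.
  by rewrite ler_norml => /andP[].
have h1 := bnd _ _ _ Cv0 se hv; have h2 := bnd _ _ _ Cw0 te hw.
have : c / (2 * (1 + Cv + Cw)) * (Cv * q) + c / (2 * (1 + Cv + Cw)) * (Cw * q)
    < c * q.
  rewrite -mulrDr -mulrDl mulrA ltr_pM2r// -mulrA gtr_pMr// mulrC.
  by rewrite ltr_pdivrMr ?mulr_gt0//; lra.
lra.
Qed.

Definition sylvester (y : M) : 'M[R]_(n * n) := lin_mx (mulmx y \+ mulmxr y).

(** Solved through an inverse matrix rather than in an eigenbasis, because eigenvectors need not
    vary smoothly with [y], whereas Cramer's rule can be differentiated. *)
Definition lyap (y A : M) : M := vec_mx (mxvec A *m invmx (sylvester y)).

Lemma sylvesterE (y U : M) :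
  mxvec U *m sylvester y = mxvec (y *m U + U *m y).
Proof. by rewrite /sylvester mul_vec_lin. Qed.

Lemma conj_anticommutator (P S U : M) (d : 'rV[R]_n) i j :
  eigendecomposition S P d ->
  (P^T *m (S *m U + U *m S) *m P) i j
  = (d ord0 i + d ord0 j) * (P^T *m U *m P) i j.
Proof.
move=> [oP ->]; have oP' := orthogonal_mxV oP.
rewrite (_ : _ *m _ *m P = diag_mx d *m (P^T *m U *m P) +
  (P^T *m U *m P) *m diag_mx d).
  by rewrite entryD mul_diag_entry mul_mx_diag_entry; ring.
by rewrite mulmxDr mulmxDl !mulmxA oP mul1mx -[_ *m P^T *m P]mulmxA oP mulmx1.
Qed.

Lemma anticommutator_eq0 (y U : M) : SPD y -> y *m U + U *m y = 0 -> U = 0.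
Proof.
move=> Sy yU; have [P [d yPd]] := spectral_theorem (SPD_sym Sy).
have d0 := SPD_eigenvalue_gt0 Sy yPd; have oP' := orthogonal_mxV yPd.1.
suff PUP : P^T *m U *m P = 0.
  have := congr1 (fun A => P *m A *m P^T) PUP.
  by rewrite !mulmxA oP' mul1mx -mulmxA oP' mulmx1 mulmx0 mul0mx.
apply/matrixP => i j; have := conj_anticommutator U i j yPd.
rewrite yU mulmx0 mul0mx !mxE => /esym/eqP; rewrite mulf_eq0 => /orP[|/eqP//].
by rewrite gt_eqF// addr_gt0.
Qed.

Lemma sylvester_unit (y : M) : SPD y -> sylvester y \in unitmx.
Proof.
move=> Sy; rewrite -row_free_unit -kermx_eq0; apply/rowV0P => u /sub_kermxP.
rewrite -[u]vec_mxK sylvesterE => /(congr1 vec_mx).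
by rewrite mxvecK linear0 => /(anticommutator_eq0 Sy) ->; rewrite linear0.
Qed.

Lemma lyapK (y A : M) : SPD y -> y *m lyap y A + lyap y A *m y = A.
Proof.
move=> Sy; apply: (can_inj mxvecK); rewrite -sylvesterE /lyap vec_mxK.
by rewrite mulmxKV// sylvester_unit.
Qed.

Lemma lyap_unique (y A U : M) : SPD y -> y *m U + U *m y = A -> lyap y A = U.
Proof.
move=> Sy <-; rewrite /lyap -sylvesterE mulmxK ?mxvecK//.
exact: sylvester_unit.
Qed.

Lemma lyapD (y A B : M) : lyap y (A + B) = lyap y A + lyap y B.
Proof. by rewrite /lyap linearD mulmxDl linearD. Qed.

Lemma lyapN (y A : M) : lyap y (- A) = - lyap y A.
Proof. by rewrite /lyap linearN mulNmx linearN. Qed.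

Lemma tr_lyap (y A : M) : SPD y -> (lyap y A)^T = lyap y A^T.
Proof.
move=> Sy; apply/esym/lyap_unique => //; rewrite -[in RHS](lyapK A Sy).
by rewrite [RHS]linearD /= !trmx_mul (SPD_sym Sy) addrC.
Qed.

Lemma lyap_sym (y A : M) : SPD y -> Sym A -> Sym (lyap y A).
Proof. by move=> Sy sA; rewrite /Sym /= tr_lyap// sA. Qed.

Lemma eigendecomposition_lyap (S P X : M) (d : 'rV[R]_n) i j :
  SPD S -> eigendecomposition S P d ->
  (P^T *m lyap S X *m P) i j = (d ord0 i + d ord0 j)^-1 * (P^T *m X *m P) i j.
Proof.
move=> SS SPd; have d0 := SPD_eigenvalue_gt0 SS SPd.
rewrite -[in RHS](lyapK X SS) (conj_anticommutator _ _ _ SPd) mulKf//.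
by rewrite gt_eqF// addr_gt0.
Qed.

Lemma mxtrace_trmul (A B : M) : \tr (A^T *m B) = \sum_i \sum_j A i j * B i j.
Proof.
rewrite exchange_big /mxtrace; apply: eq_bigr => i _; rewrite mxE.
by apply: eq_bigr => j _; rewrite mxE.
Qed.

Lemma mxtrace_conj (A P : M) : orthogonal_mx P -> \tr (P^T *m A *m P) = \tr A.
Proof.
by move=> /orthogonal_mxV oP; rewrite mxtrace_mulC mulmxA oP mul1mx.
Qed.

Lemma bures_wasserstein_eigen (S : M) : SPD S ->
  exists P : M, exists d : 'rV[R]_n, eigendecomposition S P d /\
    forall X Y, bures_wasserstein S X Y = 2^-1 * \sum_i \sum_j
      (d ord0 i + d ord0 j)^-1 * ((P^T *m X *m P) i j * (P^T *m Y *m P) i j).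
Proof.
move=> SS; set PD := get [set Pd : M * 'rV[R]_n | eigendecomposition S Pd.1 Pd.2].
exists PD.1, PD.2; split=> //.
apply: (@getPex _ [set Pd : M * 'rV[R]_n | eigendecomposition S Pd.1 Pd.2]).
have [P [d SPd]] := spectral_theorem (SPD_sym SS).
by exists (P, d).
Qed.

(** In an eigenbasis [lyap S] divides entries by d_i + d_j, and tr(A^T B) is the entrywise product
    sum, unchanged by orthogonal conjugation. No eigenbasis is left on the right-hand side. *)
Lemma bures_wassersteinE (S X Y : M) : SPD S ->
  bures_wasserstein S X Y = 2^-1 * \tr ((lyap S X)^T *m Y).
Proof.
move=> SS; have [P [d [SPd ->]]] := bures_wasserstein_eigen SS.
congr (_ * _); rewrite -(mxtrace_conj _ SPd.1).
have -> : P^T *m ((lyap S X)^T *m Y) *m P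
    = (P^T *m lyap S X *m P)^T *m (P^T *m Y *m P).
  rewrite !trmx_mul trmxK !mulmxA -[_ *m P *m P^T]mulmxA.
  by rewrite (orthogonal_mxV SPd.1) mulmx1.
rewrite mxtrace_trmul; apply: eq_bigr => i _; apply: eq_bigr => j _.
by rewrite (eigendecomposition_lyap _ _ _ SS SPd) mulrA.
Qed.

Lemma bures_wasserstein_sym (S X Y : M) : SPD S -> Sym X ->
  bures_wasserstein S X Y = 2^-1 * \tr (lyap S X *m Y).
Proof. by move=> SS sX; rewrite bures_wassersteinE// lyap_sym. Qed.

End LyapunovOperator.

(** * Derivatives of matrix-valued functions *)

Section MatrixDerivatives.
Variables (R : realType) (V : normedModType R).
Implicit Types (x v : V).

Lemma is_derive_mxP (m p : nat) (F : V -> 'M[R]_(m, p)) x v dF :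
  is_derive x v F dF <-> forall i j, is_derive x v (fun y => F y i j) (dF i j).
Proof.
split=> [[dvF <-] i j|dF'].
  have /derivable_mxP dvFij := dvF; apply: DeriveDef => //.
  by rewrite derive_mx// mxE.
have dvF : derivable F x v by apply/derivable_mxP => i j; have [] := dF' i j.
apply: DeriveDef => //; rewrite derive_mx//.
by apply/matrixP => i j; rewrite mxE; have [] := dF' i j.
Qed.

Lemma is_derive_bigsum (W : normedModType R) (I : Type) (r : seq I) (P : pred I)
    (h : I -> V -> W) (dh : I -> W) x v :
  (forall i, P i -> is_derive x v (h i) (dh i)) ->
  is_derive x v (fun y => \sum_(i <- r | P i) h i y) (\sum_(i <- r | P i) dh i).
Proof.
move=> hd; elim: r => [|i r ih].
  rewrite big_nil (_ : (fun y => _) = cst 0); first exact: is_derive_cst.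
  by apply/funext => y; rewrite big_nil.
rewrite big_cons; case: ifPn => [Pi|nPi].
  rewrite (_ : (fun y => _) = h i + (fun y => \sum_(i <- r | P i) h i y)).
    by apply: is_deriveD => //; exact: hd.
  by apply/funext => y; rewrite big_cons Pi.
rewrite (_ : (fun y => _) = (fun y => \sum_(i <- r | P i) h i y))//.
by apply/funext => y; rewrite big_cons (negbTE nPi).
Qed.

Lemma is_derive_mulmx (m p q : nat) (F : V -> 'M[R]_(m, p))
    (G : V -> 'M[R]_(p, q)) x v dF dG :
  is_derive x v F dF -> is_derive x v G dG ->
  is_derive x v (fun y => F y *m G y) (dF *m G x + F x *m dG).
Proof.
move=> /is_derive_mxP hF /is_derive_mxP hG; apply/is_derive_mxP => i j.
rewrite (_ : (fun y => _) = fun y => \sum_k F y i k * G y k j).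
  apply: is_derive_eq.
    by apply: is_derive_bigsum => k _; exact: is_deriveM.
  rewrite !mxE -big_split; apply: eq_bigr => k _ /=.
  by rewrite addrC; congr (_ + _); exact: mulrC.
by apply/funext => y; rewrite mxE.
Qed.

Lemma is_derive_trmx (m p : nat) (F : V -> 'M[R]_(m, p)) x v dF :
  is_derive x v F dF -> is_derive x v (fun y => (F y)^T) dF^T.
Proof.
move=> /is_derive_mxP hF; apply/is_derive_mxP => i j; rewrite mxE.
by rewrite (_ : (fun y => _) = fun y => F y j i)//; apply/funext => y; rewrite mxE.
Qed.

Lemma is_derive_mxtrace (m : nat) (F : V -> 'M[R]_m) x v dF :
  is_derive x v F dF -> is_derive x v (fun y => \tr (F y)) (\tr dF).
Proof. by move=> /is_derive_mxP hF; exact: is_derive_bigsum. Qed.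

Lemma derivable_bigsum (I : Type) (r : seq I) (P : pred I) (h : I -> V -> R)
    x v : (forall i, P i -> derivable (h i) x v) ->
  derivable (fun y => \sum_(i <- r | P i) h i y) x v.
Proof.
move=> dh; have hP i : P i -> is_derive x v (h i) ('D_v (h i) x).
  by move=> /dh /derivableP.
by case: (is_derive_bigsum r hP).
Qed.

Lemma derivable_bigprod (I : Type) (r : seq I) (P : pred I) (h : I -> V -> R)
    x v : (forall i, P i -> derivable (h i) x v) ->
  derivable (fun y => \prod_(i <- r | P i) h i y) x v.
Proof.
move=> dh; elim: r => [|i r ih].
  rewrite (_ : (fun y => _) = cst 1); first exact: derivable_cst.
  by apply/funext => y; rewrite big_nil.
case Pi: (P i).
  rewrite (_ : (fun y => _) = h i * (fun y => \prod_(i <- r | P i) h i y)).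
    by apply: derivableM; [exact: dh|exact: ih].
  by apply/funext => y; rewrite big_cons Pi.
rewrite (_ : (fun y => _) = (fun y => \prod_(i <- r | P i) h i y))//.
by apply/funext => y; rewrite big_cons Pi.
Qed.

Lemma derivable_det (m : nat) (F : V -> 'M[R]_m) x v :
  (forall i j, derivable (fun y => F y i j) x v) ->
  derivable (fun y => \det (F y)) x v.
Proof.
move=> dF; apply: derivable_bigsum => s _; apply: derivableM.
  exact: derivable_cst.
exact: derivable_bigprod.
Qed.

Lemma derivable_mulmx (m p q : nat) (F : V -> 'M[R]_(m, p))
    (G : V -> 'M[R]_(p, q)) x v :
  derivable F x v -> derivable G x v -> derivable (fun y => F y *m G y) x v.
Proof. by move=> /derivableP hF /derivableP hG; case: (is_derive_mulmx hF hG). Qed.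

Lemma derivable_adj (m : nat) (F : V -> 'M[R]_m) x v :
  derivable F x v -> derivable (fun y => \adj (F y)) x v.
Proof.
move=> /derivable_mxP dF; apply/derivable_mxP => i j.
rewrite (_ : (fun y => _) = fun y => cofactor (F y) j i); last first.
  by apply/funext => y; rewrite mxE.
apply: derivableM; first exact: derivable_cst.
apply: derivable_det => k l.
rewrite (_ : (fun y => _) = fun y => F y (lift j k) (lift i l))//.
by apply/funext => y; rewrite !mxE.
Qed.

End MatrixDerivatives.

(** * Derivatives at points of SPD, and of the Lyapunov solution *)

Section DerivativesOnSPD.
Variables (R : realType) (n : nat).
Local Notation M := 'M[R]_n.
Implicit Types (x y v : M).

Lemma near_SPD_line x v : SPD x -> Sym v -> \forall h \near (0 : R), SPD (h *: v + x).
Proof.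
move=> Sx sv; have [e e0 he] := SPD_open Sx sv sv.
apply: filterS (nbhs0_le e0) => h hle.
by have := he h 0; rewrite scale0r add0r normr0; apply => //; exact: ltW.
Qed.

Lemma is_derive_unique (V W : normedModType R) (f : V -> W) (a v : V) df df' :
  is_derive a v f df -> is_derive a v f df' -> df = df'.
Proof. by move=> [_ <-] [_ <-]. Qed.

(** For small h the point x + hv stays in SPD, so the difference quotients of [f] and [g] agree near
    0. This allows total functions to be replaced by any others with the same values on SPD. *)
Lemma is_derive_eq_SPD (V : normedModType R) (f g : M -> V) x v df :
  SPD x -> Sym v -> (forall y, SPD y -> f y = g y) ->
  is_derive x v f df -> is_derive x v g df.
Proof.
move=> Sx sv fg hf.
have quot : {near 0^', (fun h : R => h^-1 *: (f (h *: v + x) - f x))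
    =1 fun h => h^-1 *: (g (h *: v + x) - g x)}.
  by apply: cvg_within; near=> h; rewrite !fg//; near: h; exact: near_SPD_line.
have cf : h^-1 *: (f (h *: v + x) - f x) @[h --> 0^'] --> df.
  by case: hf => dvf <-; exact: dvf.
have cg : h^-1 *: (g (h *: v + x) - g x) @[h --> 0^'] --> df.
  exact: cvg_trans (near_eq_cvg quot) cf.
apply: DeriveDef; first by apply/cvg_ex; exists df.
exact: cvg_lim cg.
Unshelve. all: by end_near. Qed.

Lemma derive_eq_SPD (V : normedModType R) (f g : M -> V) x v :
  SPD x -> Sym v -> (forall y, SPD y -> f y = g y) -> derivable f x v ->
  'D_v f x = 'D_v g x.
Proof.
move=> Sx sv fg /derivableP hf.
by have [_ ->] := is_derive_eq_SPD Sx sv fg hf.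
Qed.

Lemma is_derive_sym (F : M -> M) x v dF : SPD x -> Sym v ->
  (forall y, SPD y -> Sym (F y)) -> is_derive x v F dF -> Sym dF.
Proof.
move=> Sx sv sF hF; have hFT := is_derive_trmx hF.
apply: is_derive_unique hFT _; apply: is_derive_eq_SPD hF => // y Sy.
by rewrite sF.
Qed.

Lemma derivable_sylvester x v : derivable (@sylvester R n) x v.
Proof.
apply/derivable_mxP => i j.
case/mxvec_indexP: j => k l; set E : M := vec_mx (delta_mx 0 i).
rewrite (_ : (fun y => _) = fun y => (y *m E + E *m y) k l); last first.
  by apply/funext => y; rewrite /sylvester /lin_mx /lin1_mx mxE /= mxvecE.
have := is_deriveD (is_derive_mulmx (is_derive_id x v) (is_derive_cst E x v))
  (is_derive_mulmx (is_derive_cst E x v) (is_derive_id x v)).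
by move=> /is_derive_mxP/(_ k l)[].
Qed.

Arguments derivable_sylvester : clear implicits.

(** On SPD the inverse of [sylvester y] is its adjugate over its nonzero determinant, both
    polynomial in the entries of [y]. Existence of the derivative is settled here so that its value
    can be found by implicit differentiation. *)
Lemma derivable_lyap (F : M -> M) x v : SPD x -> Sym v -> derivable F x v ->
  derivable (fun y => lyap y (F y)) x v.
Proof.
move=> Sx sv dF.
set G : M -> M := fun y => (\det (sylvester y))^-1 *:
  vec_mx (mxvec (F y) *m \adj (sylvester y)).
suff /derivableP hG : derivable G x v.
  suff [] : is_derive x v (fun y => lyap y (F y)) ('D_v G x) by [].
  apply: is_derive_eq_SPD hG => // y Sy.
  by rewrite /G /lyap /invmx sylvester_unit// -scalemxAr linearZ.
have dmxvec : derivable (mxvec \o F) x v.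
  apply/derivable_mxP => i j; rewrite (ord1 i); case/mxvec_indexP: j => k l.
  rewrite (_ : (fun y => _) = fun y => F y k l); last first.
    by apply/funext => y; rewrite /= mxvecE.
  by move/derivable_mxP : dF.
have /derivable_mxP dprod :=
  derivable_mulmx dmxvec (derivable_adj (derivable_sylvester x v)).
apply/derivable_mxP => i j.
rewrite (_ : (fun y => _) = (fun y => (\det (sylvester y))^-1) *
  fun y => (mxvec (F y) *m \adj (sylvester y)) ord0 (mxvec_index i j)).
  apply: derivableM => //; apply: derivableV.
    by have := sylvester_unit Sx; rewrite unitmxE unitfE.
  apply: derivable_det => k l.
  by have /derivable_mxP := derivable_sylvester x v.
by apply/funext => y; rewrite /G mxE [vec_mx _ _ _]mxE.
Qed.

(* Differentiate [y U(y) + U(y) y = F y] for [U y = lyap y (F y)]. *)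
Lemma is_derive_lyap (F : M -> M) x v dF : SPD x -> Sym v -> is_derive x v F dF ->
  is_derive x v (fun y => lyap y (F y))
    (lyap x (dF - (v *m lyap x (F x) + lyap x (F x) *m v))).
Proof.
move=> Sx sv hF; have dF' := @ex_derive _ _ _ _ _ _ _ hF.
have /derivableP hU := derivable_lyap Sx sv dF'.
apply: (is_derive_eq hU); apply/esym/lyap_unique => //.
set U := fun y => lyap y (F y); set dU := 'D_v _ x.
have hI : is_derive x v (fun y : M => y) v by exact: is_derive_id.
have hS := is_deriveD (is_derive_mulmx hI hU) (is_derive_mulmx hU hI).
have -> : dF = v *m U x + x *m dU + (dU *m x + U x *m v).
  apply: is_derive_unique hF _; apply: is_derive_eq_SPD hS => // y Sy.
  exact: lyapK.
rewrite /U; apply/matrixP => i j; rewrite !(entryD, entryN); ring.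
Qed.

End DerivativesOnSPD.

(** * Symmetry of second derivatives *)

Section MixedDerivatives.
Variables (R : realType) (V : normedModType R).
Implicit Types (x v w c : V) (f : V -> R).

Lemma is_derive_line f c v (s : R) df : is_derive (s *: v + c) v f df ->
  is_derive s 1 (fun r : R => f (r *: v + c)) df.
Proof.
have E : (fun h : R => h^-1 *: (((fun r : R => f (r *: v + c)) \o shift s) (h *: 1)
    - f (s *: v + c)))
  = fun h : R => h^-1 *: ((f \o shift (s *: v + c)) (h *: v) - f (s *: v + c)).
  by apply/funext => h /=; rewrite [h%:A]mulr1 scalerDl addrA.
case=> dvf lf; apply: DeriveDef; first by rewrite /derivable E; exact: dvf.
by rewrite /derive E; exact: lf.
Qed.

Lemma is_derive_translate f c x v df : is_derive (x + c) v f df ->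
  is_derive x v (fun y => f (y + c)) df.
Proof.
have E : (fun h : R => h^-1 *: (((fun y => f (y + c)) \o shift x) (h *: v) - f (x + c)))
  = fun h : R => h^-1 *: ((f \o shift (x + c)) (h *: v) - f (x + c)).
  by apply/funext => h /=; rewrite addrA.
case=> dvf lf; apply: DeriveDef; first by rewrite /derivable E; exact: dvf.
by rewrite /derive E; exact: lf.
Qed.

Lemma MVT_line f c v (h : R) : 0 < h ->
  (forall s, 0 <= s <= h -> derivable f (s *: v + c) v) ->
  exists2 s, 0 < s < h & f (h *: v + c) - f c = h * 'D_v f (s *: v + c).
Proof.
move=> h0 df.
have dline s : 0 <= s <= h ->
    is_derive s 1 (fun r : R => f (r *: v + c)) ('D_v f (s *: v + c)).
  by move=> /df /derivableP; exact: is_derive_line.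
have [||s] := @MVT R (fun r : R => f (r *: v + c)) (fun s => 'D_v f (s *: v + c)) 0 h h0.
- by move=> s; rewrite in_itv /= => /andP[/ltW s0 /ltW sh]; apply: dline; rewrite s0.
- by apply: derivable_within_continuous => s; rewrite in_itv /= => /dline[].
rewrite in_itv /= scale0r add0r subr0 mulrC => s0h ->.
by exists s.
Qed.

(** The mean value theorem is used twice: along [v] for f(y + hw) - f(y), then along [w] for
    ['D_v f]. The second difference on the left is symmetric in [v] and [w]. *)
Lemma mixed_difference f x v w (h : R) : 0 < h ->
  (forall s t, 0 <= s <= h -> 0 <= t <= h ->
     derivable f (s *: v + (t *: w + x)) v) ->
  (forall s t, 0 <= s <= h -> 0 <= t <= h ->
     derivable ('D_v f) (s *: v + (t *: w + x)) w) ->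
  exists s t, [/\ 0 < s < h, 0 < t < h &
    f (h *: v + (h *: w + x)) - f (h *: v + x) - (f (h *: w + x) - f x)
    = h ^+ 2 * 'D_w ('D_v f) (s *: v + (t *: w + x))].
Proof.
move=> h0 dvf dwvf; have hh : 0 <= h <= h by rewrite lexx ltW.
have h00 : 0 <= (0 : R) <= h by rewrite lexx ltW.
set g := fun y => f (y + h *: w) - f y.
have dg s : 0 <= s <= h -> is_derive (s *: v + x) v g
    ('D_v f (s *: v + (h *: w + x)) - 'D_v f (s *: v + x)).
  move=> sh; have /derivableP d1 := dvf _ _ sh hh.
  have /derivableP d0 := dvf _ _ sh h00; rewrite scale0r add0r in d0.
  rewrite [h *: w + x]addrC addrA in d1 *.
  exact: (is_deriveB (is_derive_translate d1) d0).
have [s sh|s s0h] := @MVT_line g x v h h0; first by case: (dg _ sh).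
have sh : 0 <= s <= h by case/andP: s0h => /ltW -> /ltW ->.
have [_ ->] := dg _ sh; rewrite /g.
have [t th|t t0h] := @MVT_line ('D_v f) (s *: v + x) w h h0.
  by rewrite addrCA; exact: dwvf.
rewrite [s *: v + (h *: w + x)]addrCA => -> E.
exists s, t; split => //.
by rewrite [s *: v + _]addrCA expr2 -mulrA -E [h *: w + x]addrC addrA.
Qed.

End MixedDerivatives.

Section Schwarz.
Variables (R : realType) (n : nat).
Local Notation M := 'M[R]_n.
Implicit Types (x v w : M).

Lemma smooth_derivable (V : normedModType R) (f : M -> V) x v :
  smooth f -> SPD x -> Sym v -> derivable f x v.
Proof. by move=> /(_ 1%N)[_ Hf] Sx sv; apply: (Hf v sv).1. Qed.

Lemma smooth_derive (V : normedModType R) (f : M -> V) v :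
  smooth f -> Sym v -> smooth ('D_v f).
Proof. by move=> Hf sv k; have [_ /(_ v sv)[]] := Hf k.+1. Qed.

Lemma smooth_continuous (V : normedModType R) (f : M -> V) x :
  smooth f -> SPD x -> f @ within (@SPD R n) (nbhs x) --> f x.
Proof. by move=> /(_ 0%N)[+ _] Sx => /subspace_continuousP; exact. Qed.

(** The same second difference, read in both orders, shows that the two mixed derivatives take a
    common value at two points close to [x]; continuity within SPD carries this to [x]. *)
Lemma derive_comm (f : M -> R) x v w : SPD x -> Sym v -> Sym w ->
  (forall y, SPD y -> derivable f y v) -> (forall y, SPD y -> derivable f y w) ->
  (forall y, SPD y -> derivable ('D_v f) y w) ->
  (forall y, SPD y -> derivable ('D_w f) y v) ->
  'D_w ('D_v f) @ within (@SPD R n) (nbhs x) --> 'D_w ('D_v f) x ->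
  'D_v ('D_w f) @ within (@SPD R n) (nbhs x) --> 'D_v ('D_w f) x ->
  'D_v ('D_w f) x = 'D_w ('D_v f) x.
Proof.
move=> Sx sv sw dv dw dwv dvw cwv cvw.
have [e e0 box] := SPD_open Sx sv sw.
apply/eqP; rewrite -subr_eq0 -normr_le0; apply/ler_addgt0Pr => r r0.
rewrite add0r.
have r2 : 0 < r / 2 by rewrite divr_gt0.
move/cvgrPdist_lt/(_ _ r2)/nbhs_ballP : cwv => [d1 /= d10 h1].
move/cvgrPdist_lt/(_ _ r2)/nbhs_ballP : cvw => [d2 /= d20 h2].
set K := `|v| + `|w| + 1.
have K0 : 0 < K by rewrite /K; have := normr_ge0 v; have := normr_ge0 w; lra.
(* h <= e keeps the parallelogram in SPD, and h K <= min(d1, d2) keeps it in both balls; the 1 in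
   [K] makes the distance bound strict even for zero directions. *)
set h := Num.min e (Num.min d1 d2 / K).
have h0 : 0 < h by rewrite lt_min e0 divr_gt0// lt_min d10.
have he : h <= e by rewrite ge_min lexx.
have hK : h * K <= Num.min d1 d2 by rewrite -ler_pdivlMr// ge_min lexx orbT.
have SPDst s t : 0 <= s <= h -> 0 <= t <= h -> SPD (s *: v + (t *: w + x)).
  move=> /andP[s0 sh] /andP[t0 th].
  by apply: box; rewrite ger0_norm//; apply: le_trans he.
have ball_st s t d : 0 < s < h -> 0 < t < h -> h * K <= d ->
    ball x d (s *: v + (t *: w + x)).
  move=> /andP[s0 sh] /andP[t0 th] hd; rewrite -ball_normE /ball_ /=.
  rewrite addrA opprD addrCA subrr addr0 normrN.
  apply: lt_le_trans hd; apply: le_lt_trans (ler_normD _ _) _.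
  rewrite !normrZ !gtr0_norm// /K !mulrDr mulr1.
  have : s * `|v| <= h * `|v| by rewrite ler_wpM2r// ltW.
  have : t * `|w| <= h * `|w| by rewrite ler_wpM2r// ltW.
  lra.
have [s [t [s0h t0h E]]] := mixed_difference h0
  (fun s t sh th => dv _ (SPDst s t sh th)) (fun s t sh th => dwv _ (SPDst s t sh th)).
have SPDts s' t' : 0 <= s' <= h -> 0 <= t' <= h -> SPD (s' *: w + (t' *: v + x)).
  by move=> ? ?; rewrite addrCA; exact: SPDst.
have [s' [t' [s0h' t0h' E']]] := mixed_difference h0
  (fun s t sh th => dw _ (SPDts s t sh th)) (fun s t sh th => dvw _ (SPDts s t sh th)).
have itvW (a : R) : 0 < a < h -> 0 <= a <= h by move=> /andP[/ltW -> /ltW ->].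
have := h1 _ (ball_st _ _ d1 s0h t0h _) (SPDst _ _ (itvW _ s0h) (itvW _ t0h)).
have := h2 _ (ball_st _ _ d2 t0h' s0h' _) (SPDst _ _ (itvW _ t0h') (itvW _ s0h')).
have hd1 : h * K <= d1 by apply: le_trans hK _; rewrite ge_min lexx.
have hd2 : h * K <= d2 by apply: le_trans hK _; rewrite ge_min lexx orbT.
move=> /(_ hd2) b2 /(_ hd1) b1.
have EE : 'D_w ('D_v f) (s *: v + (t *: w + x)) = 'D_v ('D_w f) (t' *: v + (s' *: w + x)).
  apply: (@mulfI _ (h ^+ 2)); first by rewrite gt_eqF// exprn_gt0.
  apply: (etrans (esym E)); rewrite [s' *: w + _]addrCA in E'.
  apply: (etrans _ E'); rewrite [h *: w + (h *: v + _)]addrCA.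
  set f1 := f _; set f2 := f _; set f3 := f _; set f4 := f _; ring.
rewrite EE in b1; move: b1 b2.
move: ('D_v ('D_w f) x) ('D_w ('D_v f) x) ('D_v ('D_w f) _) => a b m b1 b2.
rewrite (_ : a - b = (a - m) - (b - m)); last by ring.
rewrite (splitr r); apply/ltW/(le_lt_trans (ler_normB _ _)).
by apply: ltrD; [exact: b2|exact: b1].
Qed.

Lemma is_derive_entry (F : M -> M) x v i j : derivable F x v ->
  is_derive x v (fun y => F y i j) ('D_v F x i j).
Proof. by move=> /derivableP/is_derive_mxP. Qed.

(** Reduced to entries, since the mean value theorem concerns real-valued functions. *)
Lemma smooth_derive_comm (F : M -> M) x v w :
  smooth F -> SPD x -> Sym v -> Sym w -> 'D_v ('D_w F) x = 'D_w ('D_v F) x.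
Proof.
move=> sF Sx sv sw; apply/matrixP => i j.
have D1 u y : Sym u -> SPD y -> is_derive y u (fun y => F y i j) ('D_u F y i j).
  by move=> su Sy; apply: is_derive_entry; exact: smooth_derivable.
have D2 u u' y : Sym u -> Sym u' -> SPD y ->
    is_derive y u' ('D_u (fun y => F y i j)) ('D_u' ('D_u F) y i j).
  move=> su su' Sy; have sDF := smooth_derive sF su.
  apply: is_derive_eq_SPD (is_derive_entry i j (smooth_derivable sDF Sy su')) => // z Sz.
  by have [_ ->] := D1 u z su Sz.
have C2 u u' : Sym u -> Sym u' ->
    'D_u' ('D_u (fun y => F y i j)) @ within (@SPD R n) (nbhs x) -->
    'D_u' ('D_u (fun y => F y i j)) x.
  move=> su su'; have [_ ->] := D2 u u' x su su' Sx.
  have sDDF := smooth_derive (smooth_derive sF su) su'.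
  have : (fun y => 'D_u' ('D_u F) y i j) @ within (@SPD R n) (nbhs x) -->
      'D_u' ('D_u F) x i j.
    exact: (cvg_comp _ _ (smooth_continuous sDDF Sx) (@coord_continuous _ _ _ i j _)).
  apply: cvg_trans; apply: fmap_within_eq => y /set_mem Sy.
  by have [_ ->] := D2 u u' y su su' Sy.
have [_ E1] := D2 w v x sw sv Sx; have [_ E2] := D2 v w x sv sw Sx.
apply: (etrans (esym E1)); apply: (etrans _ E2).
apply: derive_comm; [exact: Sx|exact: sv|exact: sw| | | | | |].
- by move=> y Sy; case: (D1 v y sv Sy).
- by move=> y Sy; case: (D1 w y sw Sy).
- by move=> y Sy; case: (D2 v w y sv sw Sy).
- by move=> y Sy; case: (D2 w v y sw sv Sy).
- exact: C2.
- exact: C2.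
Qed.

End Schwarz.

(** * Vector fields *)

Section VectorFields.
Variables (R : realType) (n : nat).
Local Notation M := 'M[R]_n.
Implicit Types (x v w : M).

(** By induction on [k]: since SPD is open, derivatives of functions that agree on SPD agree there
    as well. *)
Lemma Ck_eq (V : normedModType R) k (f g : M -> V) :
  (forall y, SPD y -> f y = g y) -> Ck k f -> Ck k g.
Proof.
elim: k f g => [|k ih] f g fg [cf df]; split=> //.
- by apply: subspace_eq_continuous cf => y /set_mem/fg.
- by apply: subspace_eq_continuous cf => y /set_mem/fg.
move=> v sv; have [dvf Ckf] := df v sv; split=> [x Sx|].
  by have [] := is_derive_eq_SPD Sx sv fg (derivableP (dvf x Sx)).
by apply: ih Ckf => y Sy; apply: derive_eq_SPD => //; exact: dvf.
Qed.

Lemma smooth_eq (V : normedModType R) (f g : M -> V) :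
  (forall y, SPD y -> f y = g y) -> smooth f -> smooth g.
Proof. by move=> fg sf k; exact: Ck_eq (sf k). Qed.

Lemma smooth_cst (V : normedModType R) (c : V) : smooth (fun _ : M => c).
Proof.
move=> k; elim: k c => [|k ih] c; split=> //;
  [exact/continuous_subspaceT/cst_continuous|exact/continuous_subspaceT/cst_continuous|].
move=> v sv; split=> [x Sx|]; first exact: derivable_cst.
by apply: Ck_eq (ih 0) => y _; exact/esym/derive_cst.
Qed.

Lemma Ck_sub (V : normedModType R) k (f g : M -> V) :
  Ck k f -> Ck k g -> Ck k (fun y => f y - g y).
Proof.
elim: k f g => [|k ih] f g [cf df] [cg dg]; split=> //.
- by move=> y; apply: continuousB; [exact: cf|exact: cg].
- by move=> y; apply: continuousB; [exact: cf|exact: cg].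
move=> v sv; have [dvf Ckf] := df v sv; have [dvg Ckg] := dg v sv.
split=> [x Sx|]; first by apply: derivableB; [exact: dvf|exact: dvg].
apply: Ck_eq (ih _ _ Ckf Ckg) => y Sy.
by apply/esym/deriveB; [exact: dvf|exact: dvg].
Qed.

Lemma smooth_sub (V : normedModType R) (f g : M -> V) :
  smooth f -> smooth g -> smooth (fun y => f y - g y).
Proof. by move=> sf sg k; exact: Ck_sub. Qed.

Lemma vector_field_cst v : Sym v -> vector_field (fun _ : M => v).
Proof. by move=> sv; split=> //; exact: smooth_cst. Qed.

Lemma vector_field_sub (X Y : M -> M) : vector_field X -> vector_field Y ->
  vector_field (fun y => X y - Y y).
Proof.
move=> [cX sX] [cY sY]; split; first exact: smooth_sub.
by move=> y Sy; rewrite /Sym /= linearB /= sX// sY.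
Qed.

Lemma vector_field_eq (X Y : M -> M) : (forall y, SPD y -> X y = Y y) ->
  vector_field X -> vector_field Y.
Proof.
move=> XY [cX sX]; split; first exact: smooth_eq cX.
by move=> y Sy; rewrite -XY//; exact: sX.
Qed.

Lemma derivable_vector_field (X : M -> M) x v :
  vector_field X -> SPD x -> Sym v -> derivable X x v.
Proof. by move=> [sX _] Sx sv; exact: smooth_derivable. Qed.

Lemma derive_vector_field_sym (X : M -> M) x v :
  vector_field X -> SPD x -> Sym v -> Sym ('D_v X x).
Proof.
move=> vX Sx sv; have := derivableP (derivable_vector_field vX Sx sv).
by apply: is_derive_sym => //; case: vX.
Qed.

Lemma vector_field_derive (X : M -> M) v :
  vector_field X -> Sym v -> vector_field ('D_v X).
Proof.
move=> vX sv; split; first by apply: smooth_derive => //; case: vX.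
by move=> x Sx; exact: derive_vector_field_sym.
Qed.

End VectorFields.

(** * Linearity of the derivative in its direction, and moving directions *)

Section LinearityOfDerivative.
Variables (R : realType) (n : nat).
Local Notation M := 'M[R]_n.
Variables (g : M -> M -> M -> R) (nabla : (M -> M) -> (M -> M) -> M -> M).
Hypothesis nabla_lc : levi_civita g nabla.
Implicit Types (x v w : M) (X Y Z : M -> M).

(** Torsion-freeness exhibits the bracket as a difference of two fields produced by [nabla], which
    are smooth by assumption on the connection. *)
Lemma lie_bracket_vector_field X Y : vector_field X -> vector_field Y ->
  vector_field (lie_bracket X Y).
Proof.
move=> vX vY; have vXY := lc_vector_field nabla_lc vX vY.
have vYX := lc_vector_field nabla_lc vY vX.
apply: vector_field_eq (vector_field_sub vXY vYX) => x Sx.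
exact: (lc_torsion_free nabla_lc vX vY Sx).
Qed.

(* For a constant field, the torsion-free axiom expresses ['D_v Z] through
   [nabla], whose additivity and homogeneity then pass to [v]. *)
Lemma derive_nabla Z x v : vector_field Z -> SPD x -> Sym v ->
  'D_v Z x = nabla (fun _ => v) Z x - nabla Z (fun _ => v) x.
Proof.
move=> vZ Sx sv.
have := lc_torsion_free nabla_lc (vector_field_cst sv) vZ Sx.
by rewrite /lie_bracket /dir_derive derive_cst subr0 => ->.
Qed.

Lemma derive_dirD Z x v w : vector_field Z -> SPD x -> Sym v -> Sym w ->
  'D_(v + w) Z x = 'D_v Z x + 'D_w Z x.
Proof.
move=> vZ Sx sv sw; rewrite !derive_nabla//; last by rewrite /Sym /= linearD /= sv sw.
have vv := vector_field_cst sv; have vw := vector_field_cst sw.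
rewrite (lc_addl nabla_lc vv vw vZ Sx) (lc_addr nabla_lc vZ vv vw Sx).
by rewrite opprD addrACA.
Qed.

Lemma derive_dirZ Z x v (c : R) : vector_field Z -> SPD x -> Sym v ->
  'D_(c *: v) Z x = c *: 'D_v Z x.
Proof.
move=> vZ Sx sv; rewrite !derive_nabla//; last by rewrite /Sym /= linearZ /= sv.
have vv := vector_field_cst sv; have sc := @smooth_cst R n R^o c.
rewrite (lc_scalel nabla_lc sc vv vZ Sx) (lc_leibniz nabla_lc sc vZ vv Sx).
by rewrite /dir_derive derive_cst scale0r add0r scalerBr.
Qed.

Lemma derive_dirB Z x v w : vector_field Z -> SPD x -> Sym v -> Sym w ->
  'D_(v - w) Z x = 'D_v Z x - 'D_w Z x.
Proof.
move=> vZ Sx sv sw; rewrite -[- w]scaleN1r derive_dirD ?derive_dirZ ?scaleN1r//.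
by rewrite /Sym /= linearN /= sw.
Qed.

Lemma derive_dir_sum (I : Type) (r : seq I) (c : I -> R) (v : I -> M) Z x :
  vector_field Z -> SPD x -> (forall i, Sym (v i)) ->
  'D_(\sum_(i <- r) c i *: v i) Z x = \sum_(i <- r) c i *: 'D_(v i) Z x.
Proof.
move=> vZ Sx sv; have sZ a u : Sym u -> Sym (a *: u : M).
  by move=> su; rewrite /Sym /= linearZ /= su.
elim: r => [|i r ih]; first by rewrite !big_nil derive0.
rewrite !big_cons derive_dirD ?derive_dirZ ?ih//; first exact: sZ.
elim/big_ind : _ => [|a b sa sb|j _]; last exact: sZ.
  by rewrite /Sym /= trmx0.
by rewrite /Sym /= linearD /= sa sb.
Qed.

(** Indexed by all ordered pairs, hence redundant as a spanning family of Sym(n); the factor 1/2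
    lets the entries of a symmetric matrix serve as coefficients. *)
Definition sym_delta (k l : 'I_n) : M := 2^-1 *: (delta_mx k l + delta_mx l k).

Lemma sym_delta_sym k l : Sym (sym_delta k l).
Proof. by rewrite /Sym /= linearZ linearD /= !trmx_delta addrC. Qed.

Lemma sym_sum_delta v : Sym v ->
  v = \sum_(kl : 'I_n * 'I_n) v kl.1 kl.2 *: sym_delta kl.1 kl.2.
Proof.
move=> sv; rewrite -(pair_bigA _ (fun k l => v k l *: sym_delta k l)) /=.
have E1 : \sum_k \sum_l v k l *: delta_mx k l = v by rewrite -matrix_sum_delta.
have E2 : \sum_k \sum_l v k l *: delta_mx l k = v^T.
  rewrite -[in RHS]E1 linear_sum; apply: eq_bigr => k _ /=.
  rewrite linear_sum; apply: eq_bigr => l _ /=.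
  by rewrite linearZ /= trmx_delta.
have -> : \sum_k \sum_l v k l *: sym_delta k l = 2^-1 *: (v + v^T).
  rewrite -[X in _ *: (_ + X)]E2 -[X in _ *: (X + _)]E1 -big_split.
  rewrite scaler_sumr; apply: eq_bigr => k _ /=; rewrite -big_split scaler_sumr; apply: eq_bigr => l _ /=.
  by rewrite /sym_delta -scalerDr !scalerA mulrC.
rewrite sv; apply/matrixP => i j; rewrite !(entryD, entryZ); lra.
Qed.

Lemma is_derive_dir X Z x v : vector_field X -> vector_field Z ->
  SPD x -> Sym v ->
  is_derive x v (fun y => 'D_(X y) Z y)
    ('D_('D_v X x) Z x + 'D_v ('D_(X x) Z) x).
Proof.
move=> vX vZ Sx sv; set E := fun kl : 'I_n * 'I_n => sym_delta kl.1 kl.2.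
have sE kl : Sym (E kl) by exact: sym_delta_sym.
have sX y : SPD y -> Sym (X y) by case: vX => _; exact.
have sdX := derive_vector_field_sym vX Sx sv.
have decomp (W : M -> M) y u : vector_field W -> SPD y -> Sym u ->
    'D_u W y = \sum_kl u kl.1 kl.2 *: 'D_(E kl) W y.
  by move=> vW Sy su; rewrite {1}(sym_sum_delta su) (derive_dir_sum _ _ vW Sy sE).
have hF : is_derive x v
    (fun y => \sum_(kl : 'I_n * 'I_n) X y kl.1 kl.2 *: 'D_(E kl) Z y)
    (\sum_(kl : 'I_n * 'I_n) ('D_v X x kl.1 kl.2 *: 'D_(E kl) Z x
      + X x kl.1 kl.2 *: 'D_v ('D_(E kl) Z) x)).
  apply: is_derive_bigsum => kl _; apply/is_derive_mxP => i j.
  have h1 := is_derive_entry kl.1 kl.2 (derivable_vector_field vX Sx sv).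
  have h2 := is_derive_entry i j
    (derivable_vector_field (vector_field_derive vZ (sE kl)) Sx sv).
  have h := is_deriveM h1 h2.
  rewrite (_ : (fun y => _) =
    (fun y => X y kl.1 kl.2) * (fun y => 'D_(E kl) Z y i j)); last first.
    by apply/funext => y; rewrite mxE.
  apply: (is_derive_eq h).
  by rewrite entryD !entryZ addrC; congr (_ + _); exact: mulrC.
have -> : 'D_('D_v X x) Z x + 'D_v ('D_(X x) Z) x =
    \sum_(kl : 'I_n * 'I_n) ('D_v X x kl.1 kl.2 *: 'D_(E kl) Z x
      + X x kl.1 kl.2 *: 'D_v ('D_(E kl) Z) x).
  rewrite big_split; congr (_ + _); first exact: decomp.
  have [sZ _] := vZ; have sXx := sX x Sx.
  (* Linearity in the direction concerns the outer derivative of a vector field. The second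
     derivative is therefore swapped, expanded along [X x], and swapped back term by term. *)
  rewrite (smooth_derive_comm sZ Sx sv sXx).
  rewrite (decomp _ _ _ (vector_field_derive vZ sv) Sx sXx).
  by apply: eq_bigr => kl _; rewrite (smooth_derive_comm sZ Sx sv (sE kl)).
by apply: is_derive_eq_SPD hF => // y Sy; rewrite -decomp//; exact: sX.
Qed.

End LinearityOfDerivative.

(** * The Levi-Civita connection and its curvature *)

Section CurvatureAlgebra.
Variables (R : realType) (n : nat).
Local Notation M := 'M[R]_n.
Implicit Types (x v A B C K : M).

(** At A = X0 and B = Y0 this is minus the Christoffel symbol in the linear coordinates of Sym(n).
    It is trilinear, so the product rule yields one term per argument. *)
Definition christoffel x A B : M := A *m x *m B + B *m x *m A.

Lemma is_derive_christoffel (V : normedModType R) (F A B : V -> M) (y u : V)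
    v dA dB : is_derive y u F v -> is_derive y u A dA -> is_derive y u B dB ->
  is_derive y u (fun z => christoffel (F z) (A z) (B z))
    (christoffel (F y) dA (B y) + christoffel (F y) (A y) dB
     + christoffel v (A y) (B y)).
Proof.
move=> hF hA hB.
have hAB := is_derive_mulmx (is_derive_mulmx hA hF) hB.
have hBA := is_derive_mulmx (is_derive_mulmx hB hF) hA.
apply: (is_derive_eq (is_deriveD hAB hBA)); clear.
move: (F y) (A y) (B y) => x A0 B0; rewrite /christoffel !mulmxDl.
by apply/matrixP => i j; rewrite !entryD; ring.
Qed.

(** Here [a], [b], [c] stand for the Lyapunov solutions of D_X Y, D_Y X, D_Y Y, [H] and [G] for
    those of the Christoffel terms of (X0, Y0) and (Y0, Y0), and [D1], [D2], [D3] for derivatives of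
    Y. All of them cancel. Only [p] survives, twice from the first iterated derivative and once from
    the second; as p = (K + S0) / 2, this is the origin of 3/2. *)
Lemma curvature_algebra (x X0 Y0 p H G a b c D1 D2 D3 : M) :
  let S0 := X0 *m Y0 + Y0 *m X0 in let C := X0 *m Y0 - Y0 *m X0 in
  let K := p + p - S0 in
  let X1 := x *m X0 + X0 *m x in let Y1 := x *m Y0 + Y0 *m x in
  (D1 + D2 - (christoffel x (a - (p + H)) Y0 + christoffel x Y0 (a - (p + H))
      + christoffel X1 Y0 Y0) - christoffel x X0 (c - G))
  - (D3 + D2 - (christoffel x (b - (S0 - p + H)) Y0
      + christoffel x X0 (c - (Y0 *m Y0 + G)) + christoffel Y1 X0 Y0)
      - christoffel x Y0 (a - H))
  - (D1 - D3 - christoffel x (a - b) Y0)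
  = (3 / 2) *: (K *m x *m Y0 + Y0 *m x *m K + C *m x *m Y0 - Y0 *m x *m C).
Proof.
rewrite /= /christoffel.
rewrite !(mulmxDl, mulmxDr, mulNmx, mulmxN, mulmxA).
by apply/matrixP => i j; rewrite !(entryD, entryN, entryZ); field.
Qed.

Lemma mxtrace_rot4 (A B C D : M) :
  \tr (A *m B *m C *m D) = \tr (B *m C *m D *m A).
Proof. by rewrite -!mulmxA mxtrace_mulC !mulmxA. Qed.

(** Write X0 Y0 = (S0 + C) / 2 and Y0 X0 = (S0 - C) / 2. Since U -> xU + Ux is self-adjoint for the
    trace form, the pairing of K with S0 becomes one of [x, C] with S0 ([e1]), which cancels the S0
    part of the terms in C; the pairing of K with C yields tr(K x K) ([e2]). *)
Lemma mxtrace_curvature_algebra (x X0 Y0 K : M) :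
  let C := X0 *m Y0 - Y0 *m X0 in
  x *m K + K *m x = x *m C - C *m x ->
  \tr ((K *m x *m Y0 + Y0 *m x *m K + C *m x *m Y0 - Y0 *m x *m C) *m X0)
  = - (\tr (K *m x *m K) + \tr (C *m x *m C)).
Proof.
move=> C KC; set S0 := X0 *m Y0 + Y0 *m X0.
have e1 : \tr (K *m (x *m S0 + S0 *m x)) = \tr ((x *m C - C *m x) *m S0).
  rewrite -KC mulmxDr mulmxDl !mxtraceD addrC; congr (_ + _).
    by rewrite mulmxA mxtrace_mulC mulmxA.
  by rewrite mulmxA.
have e2 : \tr (K *m (x *m C - C *m x)) = \tr (K *m x *m K) *+ 2.
  rewrite -KC mulmxDr mxtraceD mulr2n !mulmxA; congr (_ + _).
  by rewrite -mulmxA mxtrace_mulC.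
move: e1 e2; rewrite /S0 /C.
rewrite !(mulmxDl, mulmxDr, mulNmx, mulmxN, mulmxA, mxtraceD, mxtraceN).
(* Cyclic rotations bring equal traces to the same word, after which the claim is linear in the
   traces. *)
have rot (A B D E F : M) : \tr (A *m B *m D *m E *m F) = \tr (B *m D *m E *m F *m A).
  by rewrite -!mulmxA mxtrace_mulC !mulmxA.
rewrite (rot Y0 x X0 Y0 X0) (rot Y0 x Y0 X0 X0).
rewrite (rot X0 Y0 x X0 Y0) (rot Y0 x X0 Y0 X0) (rot Y0 X0 x X0 Y0) (rot X0 x X0 Y0 Y0).
rewrite (rot X0 Y0 x Y0 X0) (rot Y0 x Y0 X0 X0) (rot Y0 X0 x Y0 X0) (rot X0 x Y0 X0 Y0).
rewrite (mxtrace_rot4 Y0 x K X0) (mxtrace_rot4 x K X0 Y0).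
lra.
Qed.

Lemma commutator_anticommutator (x X0 Y0 p : M) :
  let S0 := X0 *m Y0 + Y0 *m X0 in let C := X0 *m Y0 - Y0 *m X0 in
  x *m p + p *m x = x *m X0 *m Y0 + Y0 *m X0 *m x ->
  x *m (p + p - S0) + (p + p - S0) *m x = x *m C - C *m x.
Proof.
move=> S0 C; rewrite /S0 /C !(mulmxDl, mulmxDr, mulNmx, mulmxN, mulmxA).
move=> pE; apply/matrixP => i j; have := congr1 (fun A : M => A i j) pE.
by rewrite !(entryD, entryN) => ?; lra.
Qed.

End CurvatureAlgebra.

Section ConnectionFormula.
Variables (R : realType) (n : nat).
Local Notation M := 'M[R]_n.
Local Notation bw := (@bures_wasserstein R n).
Variable nabla : (M -> M) -> (M -> M) -> M -> M.
Hypothesis nabla_lc : levi_civita bw nabla.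
Implicit Types (x v w A B : M) (X Y Z : M -> M).

Lemma mxtrace_lyap x A B : SPD x ->
  \tr (lyap x A *m B) = \tr (A *m lyap x B).
Proof.
move=> Sx; rewrite -{1}(lyapK B Sx) -[in RHS](lyapK A Sx).
rewrite mulmxDr mulmxDl !mxtraceD addrC mulmxA; congr (_ + _).
  by rewrite mxtrace_mulC mulmxA.
by rewrite -!mulmxA.
Qed.

Lemma bures_wasserstein_lyapr x A B : SPD x -> Sym A ->
  bw x A B = 2^-1 * \tr (A *m lyap x B).
Proof. by move=> Sx sA; rewrite bures_wasserstein_sym// mxtrace_lyap. Qed.

Lemma derive_bures_wasserstein (W Z : M -> M) x v :
  vector_field W -> vector_field Z -> SPD x -> Sym v ->
  let W0 := lyap x (W x) in let Z0 := lyap x (Z x) in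
  'D_v (fun y => bw y (W y) (Z y) : R^o) x =
  2^-1 * (\tr ('D_v W x *m Z0) - \tr ((v *m W0 + W0 *m v) *m Z0)
          + \tr (W0 *m 'D_v Z x)).
Proof.
move=> vW vZ Sx sv W0 Z0.
have hW := is_derive_lyap Sx sv (derivableP (derivable_vector_field vW Sx sv)).
have hZ := derivableP (derivable_vector_field vZ Sx sv).
have h := is_derive_mxtrace (is_derive_mulmx hW hZ).
have {}h := is_deriveM (is_derive_cst (2^-1 : R) x v) h.
have [_ ->] : is_derive x v (fun y => bw y (W y) (Z y))
    (2^-1 * \tr (lyap x ('D_v W x - (v *m W0 + W0 *m v)) *m Z x + W0 *m 'D_v Z x)).
  have {}h := is_derive_eq h.
  apply: (is_derive_eq_SPD (f := fun y => 2^-1 * \tr (lyap y (W y) *m Z y))) => //.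
    by move=> y Sy; rewrite bures_wasserstein_sym//; case: vW => _; exact.
  by apply: h; rewrite scaler0 addr0.
by rewrite mxtraceD mxtrace_lyap// mulmxBl mxtraceD mxtraceN.
Qed.

Lemma mxtrace_eq0_sym (A : M) : Sym A ->
  (forall U, Sym U -> \tr (A *m U) = 0) -> A = 0.
Proof.
move=> sA /(_ A sA); rewrite -{1}sA mxtrace_trmul => /eqP.
rewrite psumr_eq0 => [/allP A0|i _]; last by apply: sumr_ge0 => j _; exact: sqr_ge0.
apply/matrixP => i j; have := A0 i (mem_index_enum _).
rewrite /= psumr_eq0 => [/allP/(_ j (mem_index_enum _))|k _]; last exact: sqr_ge0.
by rewrite /= mulf_eq0 orbb mxE => /eqP.
Qed.

(* Koszul's formula, with [E] a constant field. *)
Lemma nablaE X Y x : vector_field X -> vector_field Y -> SPD x ->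
  nabla X Y x = 'D_(X x) Y x
    - christoffel x (lyap x (X x)) (lyap x (Y x)).
Proof.
move=> vX vY Sx; have sXx : Sym (X x) by case: vX => _; exact.
have sYx : Sym (Y x) by case: vY => _; exact.
rewrite /christoffel; set X0 := lyap x (X x); set Y0 := lyap x (Y x).
have sX0 : Sym X0 by exact: lyap_sym. have sY0 : Sym Y0 by exact: lyap_sym.
have sym_nabla V W : vector_field V -> vector_field W -> Sym (nabla V W x).
  by move=> vV vW; have [_] := lc_vector_field nabla_lc vV vW; exact.
apply/eqP; rewrite -subr_eq0; apply/eqP; apply: mxtrace_eq0_sym => [|E0 sE0].
  rewrite /Sym /= !(trmxD, trmxN) !trmx_mul sX0 sY0 (SPD_sym Sx).
  rewrite (derive_vector_field_sym vY Sx sXx) (sym_nabla _ _ vX vY).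
  by rewrite !mulmxA [Y0 *m x *m X0 + _]addrC.
(* [E] is the tangent vector whose Lyapunov solution is the arbitrary [E0], so pairing with [E] in
   the metric is half the trace against [E0]. *)
set E := x *m E0 + E0 *m x.
have sE : Sym E by rewrite /Sym /= linearD /= !trmx_mul (SPD_sym Sx) sE0 addrC.
have lE : lyap x E = E0 by exact: lyap_unique.
pose cE := fun _ : M => E; have vE : vector_field cE by exact: vector_field_cst.
have gl A B : Sym A -> bw x A B = 2^-1 * \tr (A *m lyap x B).
  by move=> sA; rewrite bures_wasserstein_lyapr.
have gr A B : Sym A -> bw x A B = 2^-1 * \tr (lyap x A *m B).
  by move=> sA; rewrite bures_wasserstein_sym.
have m1 := lc_metric nabla_lc vX vY vE Sx.
have m2 := lc_metric nabla_lc vY vX vE Sx.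
have m3 := lc_metric nabla_lc vE vX vY Sx.
rewrite /dir_derive !derive_bures_wasserstein// in m1 m2 m3.
rewrite (gl _ _ (sym_nabla _ _ vX vY)) (gr _ _ sYx) -mulrDr in m1.
rewrite (gl _ _ (sym_nabla _ _ vY vX)) (gr _ _ sXx) -mulrDr in m2.
rewrite (gl _ _ (sym_nabla _ _ vE vX)) (gr _ _ sXx) -mulrDr in m3.
have two0 : (2^-1 : R) != 0 by rewrite invr_eq0 pnatr_eq0.
move/(mulfI two0) : m1; move/(mulfI two0) : m2; move/(mulfI two0) : m3.
have t1 := lc_torsion_free nabla_lc vX vY Sx.
have t2 := lc_torsion_free nabla_lc vX vE Sx.
have t3 := lc_torsion_free nabla_lc vY vE Sx.
move: t1 t2 t3; rewrite /lie_bracket /dir_derive /cE !derive_cst !sub0r -/cE lE -/X0 -/Y0.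
set a := nabla X Y x; set b := nabla Y X x; set c := nabla X cE x.
set c' := nabla cE X x; set d := nabla Y cE x; set d' := nabla cE Y x.
set DXY := 'D_(X x) Y x; set DYX := 'D_(Y x) X x.
set DEX := 'D_E X x; set DEY := 'D_E Y x.
move=> t1 t2 t3 m3 m2 m1.
have XE : X x = x *m X0 + X0 *m x by rewrite lyapK.
have YE : Y x = x *m Y0 + Y0 *m x by rewrite lyapK.
move: m1 m2 m3; rewrite XE YE /E.
clear -t1 t2 t3; clearbody a b c c' d d' DXY DYX DEX DEY X0 Y0.
(* Once torsion-freeness has removed [b], [c] and [d], the Koszul combination m1 + m2 - m3 cancels
   [c'] and [d'] and leaves twice the pairing of [a] with [E0]. *)
have {t1}-> : b = a - (DXY - DYX) by rewrite -t1 subKr.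
have {t2}-> : c = c' - DEX by rewrite -t2 addrC subrK.
have {t3}-> : d = d' - DEY by rewrite -t3 addrC subrK.
rewrite !mulmx0 !mxtrace0 !addr0.
rewrite !(mulmxDl, mulmxDr, mulNmx, mulmxN, mulmxA, mxtraceD, mxtraceN).
rewrite [\tr (c' *m Y0)]mxtrace_mulC [\tr (DEX *m Y0)]mxtrace_mulC.
rewrite (mxtrace_rot4 x E0 X0 Y0) (mxtrace_rot4 E0 X0 Y0 x).
rewrite (mxtrace_rot4 E0 x X0 Y0) -(mxtrace_rot4 Y0 X0 x E0).
rewrite (mxtrace_rot4 X0 E0 x Y0) (mxtrace_rot4 E0 x Y0 X0).
lra.
Qed.

(** [nablaE] holds at every point of SPD, so its right-hand side may be differentiated along [X x];
    [dY] and [dZ] are the derivatives of the Lyapunov solutions of Y and Z. *)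
Lemma nabla_nablaE X Y Z x :
  vector_field X -> vector_field Y -> vector_field Z -> SPD x ->
  let X0 := lyap x (X x) in let Y0 := lyap x (Y x) in let Z0 := lyap x (Z x) in
  let dY := lyap x ('D_(X x) Y x) - lyap x (X x *m Y0 + Y0 *m X x) in
  let dZ := lyap x ('D_(X x) Z x) - lyap x (X x *m Z0 + Z0 *m X x) in
  let W := lyap x ('D_(Y x) Z x) - lyap x (christoffel x Y0 Z0) in
  nabla X (nabla Y Z) x =
    'D_('D_(X x) Y x) Z x + 'D_(X x) ('D_(Y x) Z) x
    - (christoffel x dY Z0 + christoffel x Y0 dZ + christoffel (X x) Y0 Z0)
    - christoffel x X0 W.
Proof.
move=> vX vY vZ Sx X0 Y0 Z0 dY dZ W.
have sXx : Sym (X x) by case: vX => _; exact.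
have vYZ := lc_vector_field nabla_lc vY vZ.
rewrite (nablaE vX vYZ Sx) -/X0.
have -> : lyap x (nabla Y Z x) = W.
  by rewrite (nablaE vY vZ Sx) lyapD lyapN.
congr (_ - _).
have hD := is_derive_dir nabla_lc vY vZ Sx sXx.
have hY := is_derive_lyap Sx sXx (derivableP (derivable_vector_field vY Sx sXx)).
have hZ := is_derive_lyap Sx sXx (derivableP (derivable_vector_field vZ Sx sXx)).
rewrite lyapD lyapN -/Y0 -/dY in hY; rewrite lyapD lyapN -/Z0 -/dZ in hZ.
have hI : is_derive x (X x) (fun y : M => y) (X x) by exact: is_derive_id.
have h := is_deriveB hD (is_derive_christoffel hI hY hZ).
have {}h := is_derive_eq_SPD (g := nabla Y Z) Sx sXx _ h.
have [|_ ->] := h; first by move=> y Sy; rewrite (nablaE vY vZ Sy).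
by [].
Qed.

Lemma curvatureE X Y x :
  vector_field X -> vector_field Y -> SPD x ->
  let X0 := lyap x (X x) in let Y0 := lyap x (Y x) in
  let C := X0 *m Y0 - Y0 *m X0 in let K := lyap x (x *m C - C *m x) in
  curvature nabla X Y Y x =
  (3 / 2) *: (K *m x *m Y0 + Y0 *m x *m K + C *m x *m Y0 - Y0 *m x *m C).
Proof.
move=> vX vY Sx X0 Y0 C K.
have sXx : Sym (X x) by case: vX => _; exact.
have sYx : Sym (Y x) by case: vY => _; exact.
have vXY := lie_bracket_vector_field nabla_lc vX vY.
rewrite /curvature (nabla_nablaE vX vY vY Sx) (nabla_nablaE vY vX vY Sx).
rewrite (nablaE vXY vY Sx) -/X0 -/Y0 /lie_bracket /dir_derive.
rewrite (derive_dirB nabla_lc vY Sx (derive_vector_field_sym vY Sx sXx)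
  (derive_vector_field_sym vX Sx sYx)).
have [sY _] := vY; rewrite (smooth_derive_comm sY Sx sYx sXx).
have -> : lyap x ('D_(X x) Y x - 'D_(Y x) X x)
    = lyap x ('D_(X x) Y x) - lyap x ('D_(Y x) X x) by rewrite lyapD lyapN.
have XE : X x = x *m X0 + X0 *m x by rewrite lyapK.
have YE : Y x = x *m Y0 + Y0 *m x by rewrite lyapK.
(* Expanding X Y0 + Y0 X gives the right-hand side that defines [p] plus a Christoffel term, solved
   by [H]. The mirrored expression, with X0 and Y0 exchanged, has solution S0 - p, so no further
   unknown appears. *)
set p := lyap x (x *m X0 *m Y0 + Y0 *m X0 *m x).
have S0E : lyap x (x *m Y0 *m X0 + X0 *m Y0 *m x) = X0 *m Y0 + Y0 *m X0 - p.
  apply: (lyap_unique Sx); rewrite mulmxBr mulmxBl addrACA -opprD (lyapK _ Sx).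
  rewrite !(mulmxDl, mulmxDr, mulmxA).
  by apply/matrixP => i j; rewrite !(entryD, entryN); ring.
have KE : K = p + p - (X0 *m Y0 + Y0 *m X0).
  by apply: lyap_unique => //; apply: commutator_anticommutator; exact: lyapK.
set H := lyap x (christoffel x X0 Y0).
have PE : lyap x (X x *m Y0 + Y0 *m X x) = p + H.
  rewrite -lyapD XE !(mulmxDl, mulmxDr, mulmxA) /christoffel; congr lyap.
  by apply/matrixP => i j; rewrite !entryD; ring.
have QE : lyap x (Y x *m X0 + X0 *m Y x) = X0 *m Y0 + Y0 *m X0 - p + H.
  rewrite -S0E -lyapD YE !(mulmxDl, mulmxDr, mulmxA) /christoffel; congr lyap.
  by apply/matrixP => i j; rewrite !entryD; ring.
have TE : lyap x (Y x *m Y0 + Y0 *m Y x) = Y0 *m Y0 + lyap x (christoffel x Y0 Y0).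
  rewrite YE; apply: lyap_unique => //; rewrite mulmxDr mulmxDl addrACA lyapK//.
  rewrite !(mulmxDl, mulmxDr, mulmxA) /christoffel.
  by apply/matrixP => i j; rewrite !entryD; ring.
rewrite PE QE TE KE XE YE.
exact: curvature_algebra.
Qed.

End ConnectionFormula.

(** Lagrange's identity: twice the gap is a weighted double sum of the squares (a_i b_j - a_j
    b_i)^2. *)
Lemma weighted_cauchy_schwarz (R : realDomainType) (I : finType) (w a b : I -> R) :
  (forall i, 0 <= w i) ->
  (\sum_i w i * (a i * b i)) ^+ 2 <=
  (\sum_i w i * (a i * a i)) * (\sum_i w i * (b i * b i)).
Proof.
move=> w0; rewrite -subr_ge0.
set D := _ - _; suff : 0 <= 2 * D by rewrite pmulr_rge0.
rewrite (_ : 2 * D = \sum_i \sum_j w i * w j * (a i * b j - a j * b i) ^+ 2).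
  apply: sumr_ge0 => i _; apply: sumr_ge0 => j _.
  by apply: mulr_ge0; [exact: mulr_ge0|exact: sqr_ge0].
rewrite /D {D}.
pose u i := w i * (a i * a i); pose v i := w i * (b i * b i).
pose t i := w i * (a i * b i).
have D (f g : I -> R) : \sum_i \sum_j f i * g j = (\sum_i f i) * (\sum_i g i).
  by rewrite big_distrlr.
transitivity (\sum_i \sum_j (u i * v j + v i * u j + - 2 * t i * t j)).
  rewrite [RHS](eq_bigr (fun i => \sum_j u i * v j + \sum_j v i * u j
    + \sum_j - 2 * t i * t j)); last by move=> i _; rewrite !big_split.
  rewrite !big_split /= !D -mulr_sumr.
  by rewrite /u /v /t; ring.
by apply: eq_bigr => i _; apply: eq_bigr => j _; rewrite /u /v /t; ring.
Qed.

(** * The curvature in an eigenbasis, and its sign *)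

Section Riemann.
Variables (R : realType) (n : nat).
Local Notation M := 'M[R]_n.
Local Notation bw := (@bures_wasserstein R n).
Variable nabla : (M -> M) -> (M -> M) -> M -> M.
Hypothesis nabla_lc : levi_civita bw nabla.
Implicit Types (X Y : M -> M).

Lemma riemann_trace X Y (S : M) : vector_field X -> vector_field Y -> SPD S ->
  let C := mxbracket (lyap S (X S)) (lyap S (Y S)) in
  let K := lyap S (mxbracket S C) in
  riemann bw nabla X Y X Y S = - (3 / 4) * (\tr (K *m S *m K) + \tr (C *m S *m C)).
Proof.
move=> vX vY SS C K.
(* Symmetry of the curvature value is what allows [lyap] to be moved onto the other argument of the
   metric; it holds because that value comes from a vector field built with [nabla]. *)
have sR : Sym (curvature nabla X Y Y S).
  have vXY := lc_vector_field nabla_lc vX vY.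
  have vYY := lc_vector_field nabla_lc vY vY.
  have vB := lie_bracket_vector_field nabla_lc vX vY.
  have vR := vector_field_sub (vector_field_sub
    (lc_vector_field nabla_lc vX vYY) (lc_vector_field nabla_lc vY vXY))
    (lc_vector_field nabla_lc vB vY).
  by case: vR => _; exact.
rewrite /riemann bures_wasserstein_lyapr// (curvatureE nabla_lc)//.
rewrite -scalemxAl mxtraceZ mxtrace_curvature_algebra; last exact: lyapK.
rewrite /K /C /mxbracket; by field.
Qed.

Lemma conj_mulmx (A B P : M) : orthogonal_mx P ->
  P^T *m (A *m B) *m P = (P^T *m A *m P) *m (P^T *m B *m P).
Proof.
move=> /orthogonal_mxV oP.
by rewrite !mulmxA -[_ *m A *m P *m P^T]mulmxA oP mulmx1.
Qed.

Lemma mxtrace_conj_mul3 (A B D P : M) : orthogonal_mx P ->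
  \tr (A *m B *m D) = \tr ((P^T *m A *m P) *m (P^T *m B *m P) *m (P^T *m D *m P)).
Proof.
by move=> oP; rewrite -(mxtrace_conj (A *m B *m D) oP) !(conj_mulmx _ _ oP).
Qed.

Lemma mxtrace_diag_mul3 (A : M) (d : 'rV[R]_n) :
  \tr (A *m diag_mx d *m A) = \sum_i \sum_j d ord0 j * (A i j * A j i).
Proof.
apply: eq_bigr => i _; rewrite mxE; apply: eq_bigr => j _.
by rewrite mul_mx_diag_entry; ring.
Qed.

Lemma riemann_eigendecomposition X Y (S P X0 Y0 : M) (d : 'rV[R]_n) :
  SPD S -> eigendecomposition S P d -> vector_field X -> vector_field Y ->
  Sym X0 -> P^T *m X S *m P = diag_mx d *m X0 + X0 *m diag_mx d ->
  Sym Y0 -> P^T *m Y S *m P = diag_mx d *m Y0 + Y0 *m diag_mx d ->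
  riemann bw nabla X Y X Y S =
  3 / 2 * \sum_(i < n) \sum_(j < n)
    (d ord0 i * d ord0 j) / (d ord0 i + d ord0 j) * mxbracket X0 Y0 i j ^+ 2.
Proof.
move=> SS SPd vX vY sX0 X0E sY0 Y0E; have oP := SPd.1.
have oP' := orthogonal_mxV oP; have d0 := SPD_eigenvalue_gt0 SS SPd.
have dn0 i j : d ord0 i + d ord0 j != 0 by rewrite gt_eqF// addr_gt0.
have lyapE (A A0 : M) : P^T *m A *m P = diag_mx d *m A0 + A0 *m diag_mx d ->
    P^T *m lyap S A *m P = A0.
  move=> AE; apply/matrixP => i j.
  rewrite (eigendecomposition_lyap _ _ _ SS SPd) AE entryD.
  by rewrite mul_diag_entry mul_mx_diag_entry [_ * d _ _]mulrC -mulrDl mulKf.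
have conjB (A B : M) : P^T *m mxbracket A B *m P
    = mxbracket (P^T *m A *m P) (P^T *m B *m P).
  by rewrite /mxbracket mulmxBr mulmxBl !(conj_mulmx _ _ oP).
rewrite (riemann_trace vX vY SS).
set C := mxbracket (lyap S _) _; set K := lyap S _.
have CE : P^T *m C *m P = mxbracket X0 Y0.
  by rewrite conjB (lyapE _ _ X0E) (lyapE _ _ Y0E).
rewrite (mxtrace_conj_mul3 K S K oP) (mxtrace_conj_mul3 C S C oP) CE.
rewrite (eigendecomposition_conj SPd).
rewrite !mxtrace_diag_mul3; set c := mxbracket X0 Y0.
have cT i j : c j i = - c i j.
  have -> : c j i = c^T i j by rewrite [RHS]mxE.
  rewrite /c /mxbracket trmxD trmxN !trmx_mul sX0 sY0 !(entryD, entryN); ring.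
have KE i j : (P^T *m K *m P) i j
    = (d ord0 i - d ord0 j) / (d ord0 i + d ord0 j) * c i j.
  rewrite (eigendecomposition_lyap _ _ _ SS SPd) conjB CE (eigendecomposition_conj SPd).
  rewrite {1}/mxbracket entryD entryN mul_diag_entry mul_mx_diag_entry -/c.
  by field.
set f := fun i j => d ord0 i * d ord0 j / (d ord0 i + d ord0 j) * c i j ^+ 2.
(* K is symmetric and C antisymmetric in the eigenbasis, so d_j (K_ij K_ji + C_ij C_ji) = -4 h_ij.
   The curvature is thus 3 times the sum of [h], and f_ij = h_ij + h_ji turns 3 into 3/2. *)
set h := fun i j => d ord0 i * d ord0 j ^+ 2 / (d ord0 i + d ord0 j) ^+ 2 * c i j ^+ 2.
have fh i j : f i j = h i j + h j i.
  by rewrite /f /h (cT i j) [d ord0 j + _]addrC; field.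
have -> : \sum_i \sum_j f i j = 2 * \sum_i \sum_j h i j.
  rewrite mulr_natl mulr2n [X in _ + X]exchange_big -big_split; apply: eq_bigr => i _.
  by rewrite -big_split; apply: eq_bigr => j _; exact: fh.
rewrite -big_split mulr_sumr !mulr_sumr; apply: eq_bigr => i _.
rewrite -big_split !mulr_sumr; apply: eq_bigr => j _.
rewrite !KE (cT i j) /h [d ord0 j + _]addrC /=; field.
by rewrite dn0.
Qed.

(** The matrices X0 and Y0 required by the eigenbasis formula always exist: they are the conjugates
    of the Lyapunov solutions. Every summand is then nonnegative because the eigenvalues are
    positive. *)
Lemma riemann_ge0 X Y (S : M) : vector_field X -> vector_field Y -> SPD S ->
  0 <= riemann bw nabla X Y X Y S.
Proof.
move=> vX vY SS; have [P [d SPd]] := spectral_theorem (SPD_sym SS).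
have d0 := SPD_eigenvalue_gt0 SS SPd.
have conjE (A : M) : P^T *m A *m P =
    diag_mx d *m (P^T *m lyap S A *m P) + (P^T *m lyap S A *m P) *m diag_mx d.
  apply/matrixP => i j; rewrite -{1}(lyapK A SS) (conj_anticommutator _ _ _ SPd).
  by rewrite entryD mul_diag_entry mul_mx_diag_entry; ring.
have conj_sym (A : M) : Sym A -> Sym (P^T *m lyap S A *m P).
  by move=> sA; rewrite /Sym /= !trmx_mul trmxK (lyap_sym SS sA) mulmxA.
have sX : Sym (X S) by case: vX => _; exact.
have sY : Sym (Y S) by case: vY => _; exact.
rewrite (riemann_eigendecomposition SS SPd vX vY (conj_sym _ sX) (conjE _)
  (conj_sym _ sY) (conjE _)).
apply: mulr_ge0; first by rewrite divr_ge0.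
apply: sumr_ge0 => i _; apply: sumr_ge0 => j _.
apply: mulr_ge0; last exact: sqr_ge0.
by rewrite divr_ge0 ?mulr_ge0 ?addr_ge0// ltW.
Qed.

(** A single eigendecomposition serves all three values of the metric, which become sums over index
    pairs with the same positive weights. *)
Lemma bures_wasserstein_cauchy_schwarz (S A B : M) : SPD S ->
  bw S A B ^+ 2 <= bw S A A * bw S B B.
Proof.
move=> SS; have [P [d [SPd bwE]]] := bures_wasserstein_eigen SS.
have d0 := SPD_eigenvalue_gt0 SS SPd; rewrite !bwE.
rewrite !pair_bigA /= exprMn [leRHS]mulrACA -[X in _ <= X * _]expr2.
apply: ler_wpM2l; first exact: sqr_ge0.
apply: (weighted_cauchy_schwarz
  (w := fun ij : 'I_n * 'I_n => (d ord0 ij.1 + d ord0 ij.2)^-1)).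
by move=> ij; rewrite invr_ge0 addr_ge0// ltW.
Qed.

End Riemann.

Theorem mainTheorem5 (R : realType) (n : nat)
  (nabla : ('M[R]_n -> 'M[R]_n) -> ('M[R]_n -> 'M[R]_n) -> 'M[R]_n -> 'M[R]_n)
  (nabla_lc : levi_civita (@bures_wasserstein R n) nabla) :
  (forall (S : 'M[R]_n) (X Y : 'M[R]_n -> 'M[R]_n),
     SPD S -> vector_field X -> vector_field Y -> free [:: X S; Y S] ->
     0 <= sectional_curvature (@bures_wasserstein R n) nabla X Y S) /\
  (forall (S P : 'M[R]_n) (d : 'rV[R]_n) (X Y X0 Y0 : 'M[R]_n)
     (Xf Yf : 'M[R]_n -> 'M[R]_n),
     SPD S -> eigendecomposition S P d ->
     Sym X -> Sym Y ->
     Sym X0 -> P^T *m X *m P = diag_mx d *m X0 + X0 *m diag_mx d ->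
     Sym Y0 -> P^T *m Y *m P = diag_mx d *m Y0 + Y0 *m diag_mx d ->
     vector_field Xf -> vector_field Yf -> Xf S = X -> Yf S = Y ->
     riemann (@bures_wasserstein R n) nabla Xf Yf Xf Yf S =
     3 / 2 * \sum_(i < n) \sum_(j < n)
       (d ord0 i * d ord0 j) / (d ord0 i + d ord0 j)
         * mxbracket X0 Y0 i j ^+ 2).
Proof.
split=> [S X Y SS vX vY _|S P d X Y X0 Y0 Xf Yf SS SPd _ _ sX0 X0E sY0 Y0E vX vY XS YS].
  apply: divr_ge0; first exact: riemann_ge0.
  by rewrite subr_ge0; exact: bures_wasserstein_cauchy_schwarz.
rewrite -XS in X0E; rewrite -YS in Y0E.
exact: (riemann_eigendecomposition nabla_lc SS SPd vX vY sX0 X0E sY0 Y0E).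
Qed.
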